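(* The statement ''All but countably many reals are $2$-generic relative to some perfect tree'' fails to hold in $\Pi^1_1$-CA; that is, it is not provable in $\Pi^1_1$-CA (there is a model of $\Pi^1_1$-CA in which it is false).
   Context: $\Pi^1_1$-CA is the subsystem of second order arithmetic with comprehension for $\Pi^1_1$ formulas (with set parameters). Inside second order arithmetic, a collection of reals is countable if there is a single real whose columns include all members of the collection. A real is an element of $2^\omega$. A perfect tree is a nonempty set $T \subseteq 2^{<\omega}$ closed under initial segments such that every $\sigma \in T$ has two incompatible extensions in $T$. A real $X$ is a path through $T$ if $X|k \in T$ for all $k$, where $X|k$ is the initial segment of $X$ of length $k$. A real $X$ is $2$-generic relative to a perfect tree $T$ if $X$ is a path through $T$ and for every $\Sigma^0_2(T)$ set $S$ of finite binary strings there is a $k$ such that either $X|k \in S$ or $\sigma \notin S$ for every $\sigma \in T$ extending $X|k$. A real is $2$-generic relative to some perfect tree if such a $T$ exists. *)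

(* Defs.v *)
From Stdlib Require Import List.
Import ListNotations.

(** * The language L2 of second order arithmetic

    De Bruijn syntax with two independent families of indices, one for number
    variables and one for set variables: [AllNum] binds number variable 0 and
    leaves set variables alone, [AllSet] binds set variable 0 and leaves number
    variables alone.  The only set terms are the set variables. *)

Inductive tm : Type :=
| Var (i : nat)
| Zero
| One
| Add (t u : tm)
| Mul (t u : tm).

Inductive fm : Type :=
| Eq (t u : tm)
| Lt (t u : tm)
| Mem (t : tm) (X : nat)
| Bot
| Imp (p q : fm)
| AllNum (p : fm)
| AllSet (p : fm).

Definition Neg (p : fm) : fm := Imp p Bot.
Definition And (p q : fm) : fm := Neg (Imp p (Neg q)).
Definition Or (p q : fm) : fm := Imp (Neg p) q.
Definition Iff (p q : fm) : fm := And (Imp p q) (Imp q p).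
Definition ExNum (p : fm) : fm := Neg (AllNum (Neg p)).
Definition ExSet (p : fm) : fm := Neg (AllSet (Neg p)).

Declare Scope L2_scope.
Delimit Scope L2_scope with L2.
Bind Scope L2_scope with tm.
Bind Scope L2_scope with fm.
Notation "0" := Zero : L2_scope.
Notation "1" := One : L2_scope.
Notation "2" := (Add One One) : L2_scope.
Infix "+" := Add : L2_scope.
Infix "*" := Mul : L2_scope.
Infix "=" := Eq : L2_scope.
Infix "<" := Lt : L2_scope.
Notation "t 'IN' X" := (Mem t X%nat) (at level 70) : L2_scope.
Notation "~ p" := (Neg p) : L2_scope.
Infix "/\" := And : L2_scope.
Infix "\/" := Or : L2_scope.
Infix "<->" := Iff : L2_scope.
Infix "==>" := Imp (at level 96, right associativity) : L2_scope.

(** ** Substitution *)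

Definition scons {A : Type} (a : A) (f : nat -> A) (i : nat) : A :=
  match i with O => a | S j => f j end.

Fixpoint subst_tm (s : nat -> tm) (t : tm) : tm :=
  match t with
  | Var i => s i
  | Zero => Zero
  | One => One
  | Add t u => Add (subst_tm s t) (subst_tm s u)
  | Mul t u => Mul (subst_tm s t) (subst_tm s u)
  end.

Definition lift (n : nat) : tm -> tm := subst_tm (fun i => Var (n + i)).

Definition upN (s : nat -> tm) : nat -> tm :=
  scons (Var 0) (fun i => lift 1 (s i)).

Definition upS (r : nat -> nat) : nat -> nat :=
  scons 0 (fun i => S (r i)).

(** [s] acts on number variables, [r] renames set variables. *)
Fixpoint subst (s : nat -> tm) (r : nat -> nat) (p : fm) : fm :=
  match p with
  | Eq t u => Eq (subst_tm s t) (subst_tm s u)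
  | Lt t u => Lt (subst_tm s t) (subst_tm s u)
  | Mem t X => Mem (subst_tm s t) (r X)
  | Bot => Bot
  | Imp p q => Imp (subst s r p) (subst s r q)
  | AllNum p => AllNum (subst (upN s) r p)
  | AllSet p => AllSet (subst s (upS r) p)
  end.

Definition shiftN : fm -> fm := subst (fun i => Var (S i)) (fun X => X).
Definition shiftS : fm -> fm := subst Var S.
Definition instN (t : tm) : fm -> fm := subst (scons t Var) (fun X => X).
Definition instS (X : nat) : fm -> fm := subst Var (scons X (fun Y => Y)).

(** * Provability

    Classical two-sorted natural deduction with equality for numbers.  Axioms
    of the theory [Th] may be used under any context, so their free variables
    are read as universally quantified. *)

Inductive prf (Th : fm -> Prop) : list fm -> fm -> Prop :=
| prf_ax G p : Th p -> prf Th G p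
| prf_hyp G p : In p G -> prf Th G p
| prf_impI G p q : prf Th (p :: G) q -> prf Th G (Imp p q)
| prf_impE G p q : prf Th G (Imp p q) -> prf Th G p -> prf Th G q
| prf_raa G p : prf Th (Neg p :: G) Bot -> prf Th G p
| prf_allNI G p : prf Th (map shiftN G) p -> prf Th G (AllNum p)
| prf_allNE G p t : prf Th G (AllNum p) -> prf Th G (instN t p)
| prf_allSI G p : prf Th (map shiftS G) p -> prf Th G (AllSet p)
| prf_allSE G p X : prf Th G (AllSet p) -> prf Th G (instS X p)
| prf_refl G t : prf Th G (Eq t t)
| prf_leib G p t u :
    prf Th G (Eq t u) -> prf Th G (instN t p) -> prf Th G (instN u p).

Definition provable (Th : fm -> Prop) (p : fm) : Prop := prf Th [] p.

(** * L2-structures and satisfaction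

    [sets M] is the collection of subsets of the number domain over which the
    set quantifiers range. *)

Record structure : Type := {
  dom : Type;
  zero : dom;
  one : dom;
  add : dom -> dom -> dom;
  mul : dom -> dom -> dom;
  lt : dom -> dom -> Prop;
  sets : (dom -> Prop) -> Prop
}.

Fixpoint eval (M : structure) (v : nat -> dom M) (t : tm) : dom M :=
  match t with
  | Var i => v i
  | Zero => zero M
  | One => one M
  | Add t u => add M (eval M v t) (eval M v u)
  | Mul t u => mul M (eval M v t) (eval M v u)
  end.

Fixpoint sat (M : structure) (v : nat -> dom M) (w : nat -> dom M -> Prop)
    (p : fm) : Prop :=
  match p with
  | Eq t u => eval M v t = eval M v u
  | Lt t u => lt M (eval M v t) (eval M v u)
  | Mem t X => w X (eval M v t)
  | Bot => False
  | Imp p q => sat M v w p -> sat M v w q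
  | AllNum p => forall a : dom M, sat M (scons a v) w p
  | AllSet p => forall X : dom M -> Prop, sets M X -> sat M v (scons X w) p
  end.

Definition models (M : structure) (p : fm) : Prop :=
  forall (v : nat -> dom M) (w : nat -> dom M -> Prop),
    (forall i, sets M (w i)) -> sat M v w p.

(** * The theory Pi^1_1-CA *)

Fixpoint arithmetical (p : fm) : Prop :=
  match p with
  | Imp p q => arithmetical p /\ arithmetical q
  | AllNum p => arithmetical p
  | AllSet _ => False
  | _ => True
  end.

Definition Pi11 (p : fm) : Prop :=
  exists q : fm, arithmetical q /\ p = AllSet q.

(** In [induction_ax p] and [comprehension_ax p] the distinguished number
    variable of [p] is variable 0; all others are parameters. *)

Definition induction_ax (p : fm) : fm :=
  (instN 0 p ==>
   AllNum (p ==> subst (scons (Var 0 + 1) (fun i => Var (S i))) (fun X => X) p) ==>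
   AllNum p)%L2.

Definition comprehension_ax (p : fm) : fm :=
  ExSet (AllNum (Var 0 IN 0 <-> shiftS p))%L2.

(** Without the subscript 0 of Pi^1_1-CA_0: the induction scheme is present for
    all L2-formulas. *)
Inductive Pi11CA : fm -> Prop :=
| ax_succ_neq0 : Pi11CA (~ (Var 0 + 1 = 0))%L2
| ax_succ_inj : Pi11CA (Var 0 + 1 = Var 1 + 1 ==> Var 0 = Var 1)%L2
| ax_add0 : Pi11CA (Var 0 + 0 = Var 0)%L2
| ax_addS : Pi11CA (Var 0 + (Var 1 + 1) = (Var 0 + Var 1) + 1)%L2
| ax_mul0 : Pi11CA (Var 0 * 0 = 0)%L2
| ax_mulS : Pi11CA (Var 0 * (Var 1 + 1) = Var 0 * Var 1 + Var 0)%L2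
| ax_lt0 : Pi11CA (~ (Var 0 < 0))%L2
| ax_ltS : Pi11CA (Var 0 < Var 1 + 1 <-> (Var 0 < Var 1 \/ Var 0 = Var 1))%L2
| ax_ind p : Pi11CA (induction_ax p)
| ax_comp p : Pi11 p -> Pi11CA (comprehension_ax p).

(** * Formalization of the statement inside L2

    The definitions below are L2-formulas with number arguments given as terms
    and set arguments given as set variables.  Number arguments are lifted under
    number quantifiers, set arguments are incremented under set quantifiers. *)

Definition pair (s t : tm) : tm := ((s + t) * (s + t) + s)%L2.

(** ** Finite binary strings

    The string b_0...b_(k-1) is coded by the number with binary numeral
    1 b_0...b_(k-1); thus the empty string is 1, appending the bit b to s gives
    2s + b, and exactly the nonzero numbers are codes. *)

Definition Str (s : tm) : fm := (~ (s = 0))%L2.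

(** [p] is a power of 2: every divisor other than 1 is even. *)
Definition Pow2 (p : tm) : fm :=
  (~ (p = 0) /\
   AllNum (AllNum (let d := Var 1 in let q := Var 0 in
     lift 2 p = d * q ==> (d = 1 \/ ExNum (lift 1 d = 2 * Var 0)))))%L2.

(** The string [t] extends (or equals) the string [s]. *)
Definition Ext (s t : tm) : fm :=
  (Str s /\
   ExNum (ExNum (let p := Var 1 in let r := Var 0 in
     Pow2 p /\ r < p /\ lift 2 t = lift 2 s * p + r)))%L2.

(** Goedel's beta function: [r] is the remainder of [a] modulo 1 + (i+1)b. *)
Definition Beta (a b i r : tm) : fm :=
  (r < 1 + (i + 1) * b /\
   ExNum (lift 1 a = Var 0 * (1 + (lift 1 i + 1) * lift 1 b) + lift 1 r))%L2.

(** [s] is X|k: there is a finite sequence, coded by [a] and [b], consisting of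
    X|0, ..., X|k, and [s] is its last entry. *)
Definition Restr (X : nat) (k s : tm) : fm :=
  ExNum (ExNum (let a := Var 1 in let b := Var 0 in
    Beta a b 0 1 /\
    AllNum (let a := Var 2 in let b := Var 1 in let i := Var 0 in
      i < lift 3 k ==>
      ExNum (ExNum (
        let a := Var 4 in let b := Var 3 in let i := Var 2 in
        let c := Var 1 in let d := Var 0 in
        Beta a b i c /\ Beta a b (i + 1) d /\
        ((i IN X /\ d = 2 * c + 1) \/ (~ (i IN X) /\ d = 2 * c))))) /\
    Beta a b (lift 2 k) (lift 2 s)))%L2.

Definition PathThrough (X T : nat) : fm :=
  AllNum (ExNum (let k := Var 1 in let s := Var 0 in
    Restr X k s /\ s IN T))%L2.

Definition PerfectTree (T : nat) : fm :=
  (ExNum (Var 0 IN T) /\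
   AllNum (Var 0 IN T ==> Str (Var 0)) /\
   AllNum (AllNum (let s := Var 1 in let t := Var 0 in
     s IN T ==> Ext t s ==> t IN T)) /\
   AllNum (Var 0 IN T ==>
     ExNum (ExNum (let s := Var 2 in let t := Var 1 in let u := Var 0 in
       t IN T /\ u IN T /\ Ext s t /\ Ext s u /\
       ~ Ext t u /\ ~ Ext u t))))%L2.

(** ** Sigma^0_2(T) sets

    A Sigma^0_2(T) set is one defined by a formula (exists a)(forall b) theta
    with theta bounded (Delta^0_0) in the parameter T.  To quantify over theta
    in L2, bounded formulas are coded by numbers and evaluated by a satisfaction
    class.  The coded syntax is again de Bruijn; the environment x_0, x_1, ... is
    coded by the number [pair x_0 (pair x_1 ...)].  A number that is not a code
    is treated as a term without value, or as a false formula. *)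

Definition c3 : tm := (2 + 1)%L2.
Definition c4 : tm := (c3 + 1)%L2.
Definition c5 : tm := (c4 + 1)%L2.

Definition tVar (i : tm) : tm := pair 0 i.
Definition tZero : tm := pair 1 0.
Definition tOne : tm := pair 2 0.
Definition tAdd (x y : tm) : tm := pair c3 (pair x y).
Definition tMul (x y : tm) : tm := pair c4 (pair x y).

Definition fEq (x y : tm) : tm := pair 0 (pair x y).
Definition fLt (x y : tm) : tm := pair 1 (pair x y).
Definition fMem (x : tm) : tm := pair 2 x.
Definition fNeg (f : tm) : tm := pair c3 f.
Definition fAnd (f g : tm) : tm := pair c4 (pair f g).
(** (exists z < x) f, where z is variable 0 of f and does not occur in x *)
Definition fBEx (x f : tm) : tm := pair c5 (pair x f).

(** [V] contains (x, s, n): the term coded by [x] has value [n] in the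
    environment [s]. *)
Definition Val (V : nat) (x s n : tm) : fm := (pair x (pair s n) IN V)%L2.

Definition ValClass (V : nat) : fm :=
  AllNum (AllNum (AllNum (
    let x := Var 2 in let s := Var 1 in let n := Var 0 in
    Val V x s n <->
    ((x = tVar 0 /\ ExNum (lift 1 s = pair (lift 1 n) (Var 0))) \/
     ExNum (ExNum (ExNum (
       let x := Var 5 in let s := Var 4 in let n := Var 3 in
       let i := Var 2 in let y := Var 1 in let s' := Var 0 in
       x = tVar (i + 1) /\ s = pair y s' /\ Val V (tVar i) s' n))) \/
     (x = tZero /\ n = 0) \/
     (x = tOne /\ n = 1) \/
     ExNum (ExNum (ExNum (ExNum (
       let x := Var 6 in let s := Var 5 in let n := Var 4 in
       let y := Var 3 in let z := Var 2 in let m := Var 1 in let l := Var 0 in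
       Val V y s m /\ Val V z s l /\
       ((x = tAdd y z /\ n = m + l) \/ (x = tMul y z /\ n = m * l)))))))))
  )%L2.

(** [Z] contains (f, s): the bounded formula coded by [f] is true in the
    environment [s], with the set parameter interpreted by [T]. *)
Definition Sat (Z : nat) (f s : tm) : fm := (pair f s IN Z)%L2.

Definition SatClass (T V Z : nat) : fm :=
  AllNum (AllNum (
    let f := Var 1 in let s := Var 0 in
    Sat Z f s <->
    (ExNum (ExNum (ExNum (ExNum (
       let f := Var 5 in let s := Var 4 in
       let x := Var 3 in let y := Var 2 in let m := Var 1 in let n := Var 0 in
       Val V x s m /\ Val V y s n /\
       ((f = fEq x y /\ m = n) \/ (f = fLt x y /\ m < n)))))) \/
     ExNum (ExNum (
       let f := Var 3 in let s := Var 2 in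
       let x := Var 1 in let m := Var 0 in
       f = fMem x /\ Val V x s m /\ m IN T)) \/
     ExNum (
       let f := Var 2 in let s := Var 1 in let g := Var 0 in
       f = fNeg g /\ ~ Sat Z g s) \/
     ExNum (ExNum (
       let f := Var 3 in let s := Var 2 in
       let g := Var 1 in let h := Var 0 in
       f = fAnd g h /\ Sat Z g s /\ Sat Z h s)) \/
     ExNum (ExNum (ExNum (ExNum (
       let f := Var 5 in let s := Var 4 in
       let x := Var 3 in let g := Var 2 in let m := Var 1 in let z := Var 0 in
       f = fBEx x g /\ Val V x s m /\ z < m /\ Sat Z g (pair z s))))))))%L2.

(** [S'] is a Sigma^0_2(T) set of strings: for some bounded formula [f],
    [S'] is the set of strings s such that (exists a)(forall b) f(b, a, s). *)
Definition Sigma02 (S' T : nat) : fm :=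
  ExSet (ExSet (
    let S' := S (S S') in let T := S (S T) in let V := 1%nat in let Z := 0%nat in
    ValClass V /\ SatClass T V Z /\
    ExNum (AllNum (
      Var 0 IN S' <->
      (Str (Var 0) /\
       ExNum (AllNum (
         let f := Var 3 in let s := Var 2 in let a := Var 1 in let b := Var 0 in
         Sat Z f (pair b (pair a (pair s 0)))))))))%L2).

(** ** The statement *)

Definition TwoGeneric (X T : nat) : fm :=
  (PathThrough X T /\
   AllSet (let X := S X in let T := S T in let S' := 0%nat in
     Sigma02 S' T ==>
     ExNum (ExNum (let k := Var 1 in let s := Var 0 in
       Restr X k s /\
       (s IN S' \/
        AllNum (let s := Var 1 in let t := Var 0 in
          t IN T ==> Ext s t ==> ~ (t IN S')))))))%L2.

Definition TwoGenericForSomePerfectTree (X : nat) : fm :=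
  ExSet (let X := S X in let T := 0%nat in PerfectTree T /\ TwoGeneric X T)%L2.

(** Some set W has every real X that is not 2-generic relative to some perfect
    tree among its columns {x : pair i x IN W}. *)
Definition all_but_countably_many_2generic : fm :=
  ExSet (AllSet (let W := 1%nat in let X := 0%nat in
    ~ TwoGenericForSomePerfectTree X ==>
    ExNum (AllNum (let i := Var 1 in let x := Var 0 in
      x IN X <-> pair i x IN W))))%L2.

(* Main.v *)
From Stdlib Require Import Arith Lia List Classical ClassicalEpsilon.
From Stdlib Require Import FunctionalExtensionality PropExtensionality Cantor.
Import ListNotations.
Require Import Defs.

(** The statement is refuted in an omega-model which satisfies Pi^1_1-CA; its
    unprovability then follows by soundness.

    The model. A tower is a finite sequence of sets in which each set is the
    greatest solution, with respect to inclusion, of a Pi^0_2 condition without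
    parameters in which the earlier sets are held fixed. The sets of the model
    are the members of towers; up to complements and coding, the finite iterates
    of the hyperjump form towers.

    It satisfies Pi^1_1-CA. Given a Pi^0_2 condition P(w, H), let V be the set of
    strings which have an extension H with P(w, H). Then V is the greatest set
    of strings such that every member has, for each instance of P, an extension
    in the set which forces the instance. This is a Pi^0_2 condition on V, so V
    can be added to the tower ([Tower_solvable]), and then also the solution
    obtained from a string in V by always taking the least possible extension
    ([solution_InM]). An arithmetical formula with a set variable X is expressed
    by a Pi^0_2 condition on the join H of X with the truth sets of its
    subformulas ([arith_system]). Consequently a true Sigma^1_1 statement with
    parameters in the model has a witness in the model ([InM_basis]), and sets
    defined by Pi^1_1 formulas can be read off from V ([InM_comprehension]).

    The join G of a tower is not 2-generic relative to any perfect tree T. Take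
    the first set of the tower, the greatest solution of P. The strings above
    which no string of T forces some instance of P form a Sigma^0_2(T) set which
    G does not meet. If G is 2-generic, then above some initial segment of G
    every string of T lies on a solution of P, and so it has no entry 1 outside
    the greatest solution. Hence the elements of the greatest solution are the
    numbers at which some such string has entry 1, and the strings which have
    entry 0 at one of them form a Sigma^0_1(T) set, again not met by G. Thus above
    some initial segment all strings of T agree with G on the first column.
    Iterating over the finitely many columns, T has no other path than G above
    some initial segment and is not perfect ([decided_all], [not_generic]).

    Diagonalization. Suppose that a set W of the model has all sets that are not
    2-generic among its columns, in particular the joins of all towers. The set
    D of [diagonal_InM] is in the model, say as entry j of a tower of length N
    whose join is column i of W; but D was made to differ from that entry at the
    number coding i, N and j. *)

(** * Satisfaction, substitution and soundness *)

Lemma eval_subst M v s t :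
  eval M v (subst_tm s t) = eval M (fun i => eval M v (s i)) t.
Proof. induction t; simpl; congruence. Qed.

Lemma all_iff {A} (P Q : A -> Prop) :
  (forall a, P a <-> Q a) -> (forall a, P a) <-> (forall a, Q a).
Proof. firstorder. Qed.

Lemma sat_subst M p : forall v w s r,
  sat M v w (subst s r p) <->
  sat M (fun i => eval M v (s i)) (fun X => w (r X)) p.
Proof.
  induction p as [t u|t u|t X| |p IHp q IHq|p IHp|p IHp]; intros v w s r; simpl;
    rewrite ?eval_subst; try tauto.
  - rewrite IHp, IHq. tauto.
  - apply all_iff. intros a. rewrite IHp.
    replace (fun i => eval M (scons a v) (upN s i))
      with (scons a (fun i => eval M v (s i))); [reflexivity|].
    extensionality i. destruct i as [|i]; [reflexivity|].
    simpl. unfold lift. rewrite eval_subst. reflexivity.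
  - apply all_iff. intros X. apply all_iff. intros _. rewrite IHp.
    replace (fun i => scons X w (upS r i))
      with (scons X (fun i => w (r i))); [reflexivity|].
    extensionality i. destruct i; reflexivity.
Qed.

Lemma sat_instN M v w t p :
  sat M v w (instN t p) <-> sat M (scons (eval M v t) v) w p.
Proof.
  unfold instN. rewrite sat_subst.
  replace (fun i => eval M v (scons t Var i)) with (scons (eval M v t) v);
    [reflexivity|].
  extensionality i. destruct i; reflexivity.
Qed.

Lemma sat_instS M v w X p :
  sat M v w (instS X p) <-> sat M v (scons (w X) w) p.
Proof.
  unfold instS. rewrite sat_subst.
  replace (fun Y => w (scons X (fun Z => Z) Y)) with (scons (w X) w);
    [reflexivity|].
  extensionality i. destruct i; reflexivity.
Qed.

Lemma soundness M Th :
  (forall p, Th p -> models M p) ->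
  forall G p, prf Th G p ->
  forall v w, (forall i, sets M (w i)) ->
  (forall g, In g G -> sat M v w g) -> sat M v w p.
Proof.
  intros HTh G p D.
  induction D as [G p Hp|G p Hp|G p q _ IH|G p q _ IH1 _ IH2|G p _ IH|G p _ IH
    |G p t _ IH|G p _ IH|G p X _ IH|G t|G p t u _ IH1 _ IH2]; intros v w Hw HG.
  - apply HTh; assumption.
  - apply HG; assumption.
  - intros Hp. apply IH; [assumption|]. intros g [<-|Hg]; auto.
  - apply (IH1 v w Hw HG). apply (IH2 v w Hw HG).
  - apply NNPP. intros Hn. apply (IH v w Hw).
    intros g [<-|Hg]; [exact Hn|auto].
  - intros a. apply IH; [assumption|]. intros g Hg.
    apply in_map_iff in Hg. destruct Hg as (g' & <- & Hg').
    apply sat_subst. exact (HG g' Hg').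
  - apply sat_instN. apply (IH v w Hw HG).
  - intros X HX. apply IH; [intros [|i]; simpl; auto|]. intros g Hg.
    apply in_map_iff in Hg. destruct Hg as (g' & <- & Hg').
    apply sat_subst. exact (HG g' Hg').
  - apply sat_instS. apply (IH v w Hw HG). apply Hw.
  - reflexivity.
  - apply sat_instN. rewrite <- (IH1 v w Hw HG). apply sat_instN. auto.
Qed.

Fixpoint ev (e : nat -> nat) (t : tm) : nat :=
  match t with
  | Var i => e i
  | Zero => 0
  | One => 1
  | Add t u => ev e t + ev e u
  | Mul t u => ev e t * ev e u
  end.

Definition std (S : (nat -> Prop) -> Prop) : structure :=
  {| dom := nat; zero := 0; one := 1; add := Nat.add; mul := Nat.mul;
     lt := Peano.lt; sets := S |}.

Lemma eval_std S v t : eval (std S) v t = ev v t.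
Proof. induction t; simpl; congruence. Qed.

Lemma ev_subst e s t : ev e (subst_tm s t) = ev (fun i => ev e (s i)) t.
Proof. induction t; simpl; congruence. Qed.

Lemma ev_lift1 a e t : ev (scons a e) (lift 1 t) = ev e t.
Proof. unfold lift. rewrite ev_subst. reflexivity. Qed.

Lemma ev_lift2 a b e t : ev (scons a (scons b e)) (lift 2 t) = ev e t.
Proof. unfold lift. rewrite ev_subst. reflexivity. Qed.

Lemma ev_lift3 a b c e t :
  ev (scons a (scons b (scons c e))) (lift 3 t) = ev e t.
Proof. unfold lift. rewrite ev_subst. reflexivity. Qed.

Lemma not_all_not {A} (P Q : A -> Prop) :
  (forall a, P a <-> Q a) -> ~ (forall a, ~ P a) <-> exists a, Q a.
Proof.
  intros H. split.
  - intros H'. apply NNPP. intros Hn. apply H'. intros a Ha. apply Hn.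
    exists a. apply H, Ha.
  - intros [a Ha] H'. apply (H' a), H, Ha.
Qed.

Section Connectives.
Context (S : (nat -> Prop) -> Prop) (v : nat -> nat) (w : nat -> nat -> Prop).
Notation "'[' p ']'" := (sat (std S) v w p).

Lemma sat_Eq t u (m n : nat) : ev v t = m -> ev v u = n -> [Eq t u] <-> m = n.
Proof. simpl. rewrite !eval_std. intros -> ->. reflexivity. Qed.

Lemma sat_Lt t u (m n : nat) : ev v t = m -> ev v u = n -> [Lt t u] <-> m < n.
Proof. simpl. rewrite !eval_std. intros -> ->. reflexivity. Qed.

Lemma sat_Mem t X (m : nat) (A : nat -> Prop) :
  ev v t = m -> w X = A -> [Mem t X] <-> A m.
Proof. simpl. rewrite !eval_std. intros -> ->. reflexivity. Qed.

Lemma sat_Imp p q (P Q : Prop) :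
  [p] <-> P -> [q] <-> Q -> [Imp p q] <-> (P -> Q).
Proof. simpl. tauto. Qed.

Lemma sat_Neg p (P : Prop) : [p] <-> P -> [Neg p] <-> ~ P.
Proof. simpl. tauto. Qed.

Lemma sat_And p q (P Q : Prop) :
  [p] <-> P -> [q] <-> Q -> [And p q] <-> P /\ Q.
Proof. simpl. tauto. Qed.

Lemma sat_Or p q (P Q : Prop) :
  [p] <-> P -> [q] <-> Q -> [Or p q] <-> P \/ Q.
Proof. simpl. tauto. Qed.

Lemma sat_Iff p q (P Q : Prop) :
  [p] <-> P -> [q] <-> Q -> [Iff p q] <-> (P <-> Q).
Proof. simpl. tauto. Qed.

Lemma sat_AllNum p (P : nat -> Prop) :
  (forall a, sat (std S) (scons a v) w p <-> P a) ->
  [AllNum p] <-> forall a, P a.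
Proof. apply all_iff. Qed.

Lemma sat_ExNum p (P : nat -> Prop) :
  (forall a, sat (std S) (scons a v) w p <-> P a) ->
  [ExNum p] <-> exists a, P a.
Proof. apply not_all_not. Qed.

Lemma sat_AllSet p (P : (nat -> Prop) -> Prop) :
  (forall X, sat (std S) v (scons X w) p <-> P X) ->
  [AllSet p] <-> forall X, S X -> P X.
Proof. intros H. apply all_iff. intros X. apply all_iff. intros _. apply H. Qed.

Lemma sat_ExSet p (P : (nat -> Prop) -> Prop) :
  (forall X, sat (std S) v (scons X w) p <-> P X) ->
  [ExSet p] <-> exists X, S X /\ P X.
Proof.
  intros H. rewrite <- (not_all_not (fun X => S X /\ P X)) by reflexivity.
  apply not_iff_compat, all_iff. intros X.
  generalize (H X). simpl. tauto.
Qed.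
End Connectives.

(** Translates a formula of L2, connective by connective, into the proposition
    on the right of the equivalence to be proved; leaves the atoms. *)
Ltac sat_step :=
  match goal with
  | |- sat _ _ _ (And _ _) <-> _ => apply sat_And
  | |- sat _ _ _ (Or _ _) <-> _ => apply sat_Or
  | |- sat _ _ _ (Iff _ _) <-> _ => apply sat_Iff
  | |- sat _ _ _ (ExNum _) <-> _ => apply sat_ExNum; intro; cbv zeta
  | |- sat _ _ _ (ExSet _) <-> _ => apply sat_ExSet; intro; cbv zeta
  | |- sat _ _ _ (Neg _) <-> _ => apply sat_Neg
  | |- sat _ _ _ (Imp _ _) <-> _ => apply sat_Imp
  | |- sat _ _ _ (AllNum _) <-> _ => apply sat_AllNum; intro; cbv zeta
  | |- sat _ _ _ (AllSet _) <-> _ => apply sat_AllSet; intro; cbv zeta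
  | |- sat _ _ _ (Eq _ _) <-> _ => apply sat_Eq
  | |- sat _ _ _ (Lt _ _) <-> _ => apply sat_Lt
  | |- sat _ _ _ (Mem _ _) <-> _ => apply sat_Mem
  end.


(** * Goedel's beta function and exponentiation *)

Definition beta (a b i r : nat) : Prop :=
  r < 1 + (i + 1) * b /\ exists q, a = q * (1 + (i + 1) * b) + r.

Lemma beta_fun a b i r r' : beta a b i r -> beta a b i r' -> r = r'.
Proof.
  intros [Hr [q E]] [Hr' [q' E']].
  apply (Nat.mod_unique a _ q) in Hr; [|lia].
  apply (Nat.mod_unique a _ q') in Hr'; [|lia]. congruence.
Qed.

Fixpoint prodn (m : nat -> nat) (k : nat) : nat :=
  match k with 0 => 1 | S k => prodn m k * m k end.

Lemma prodn_divide m k i : i < k -> Nat.divide (m i) (prodn m k).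
Proof.
  induction k as [|k IH]; simpl; [lia|]. intros H.
  destruct (Nat.eq_dec i k) as [->|D].
  - apply Nat.divide_factor_r.
  - apply Nat.divide_mul_l, IH. lia.
Qed.

Lemma prodn_pos m k : (forall i, 0 < m i) -> 0 < prodn m k.
Proof. intros H. induction k; simpl; [lia|]. specialize (H k). nia. Qed.

Lemma coprime_prodn m k d :
  (forall i, i < k -> Nat.gcd d (m i) = 1) -> Nat.gcd d (prodn m k) = 1.
Proof.
  induction k as [|k IH]; simpl; intros H; [apply Nat.divide_1_r, Nat.gcd_divide_r|].
  set (g := Nat.gcd d (prodn m k * m k)).
  assert (Hd : Nat.divide g d) by apply Nat.gcd_divide_l.
  assert (Hg : Nat.gcd g (prodn m k) = 1).
  { apply Nat.divide_1_r. rewrite <- IH by auto. apply Nat.gcd_greatest.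
    - eapply Nat.divide_trans; [apply Nat.gcd_divide_l|exact Hd].
    - apply Nat.gcd_divide_r. }
  apply Nat.divide_1_r. rewrite <- (H k) by lia. apply Nat.gcd_greatest; [exact Hd|].
  apply (Nat.gauss g (prodn m k)); [apply Nat.gcd_divide_r|exact Hg].
Qed.

Lemma chinese_remainder (m f : nat -> nat) k :
  (forall i, 0 < m i) ->
  (forall i j, i < j < k -> Nat.gcd (m j) (m i) = 1) ->
  exists a, forall i, i < k -> exists q, a = q * m i + f i mod m i.
Proof.
  intros Hm. induction k as [|k IH]; intros Hc; [exists 0; lia|].
  destruct IH as [a Ha]; [intros; apply Hc; lia|].
  assert (Hp := prodn_pos m k Hm).
  destruct (Nat.gcd_bezout_pos (prodn m k) (m k) Hp) as (u & v & E).
  rewrite Nat.gcd_comm, coprime_prodn in E by (intros; apply Hc; lia).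
  set (t := f k mod m k + (m k - 1) * a).
  exists (a + prodn m k * u * t). intros i Hi.
  destruct (Nat.eq_dec i k) as [->|D].
  - exists (a + v * t). specialize (Hm k).
    rewrite (Nat.mul_comm (prodn m k) u), E.
    unfold t. generalize (f k mod m k). intros F.
    replace (m k) with (S (m k - 1)) by lia. rewrite Nat.sub_succ, Nat.sub_0_r. ring.
  - destruct (Ha i) as [q Hq]; [lia|].
    destruct (prodn_divide m k i) as [z Hz]; [lia|].
    exists (q + z * u * t). rewrite Hz. nia.
Qed.

Lemma divide_fact n i : 0 < i <= n -> Nat.divide i (fact n).
Proof.
  induction n as [|n IH]; [lia|]. intros H.
  change (fact (S n)) with (S n * fact n).
  destruct (Nat.eq_dec i (S n)) as [->|D].
  - apply Nat.divide_factor_l.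
  - apply Nat.divide_mul_r, IH. lia.
Qed.

(** The moduli [1 + (i+1)b] are pairwise coprime as soon as [b] is divisible by
    every difference of two indices: a common divisor of two of them divides
    the difference of the indices, hence [b], hence 1. *)
Lemma beta_exists (f : nat -> nat) n :
  exists a b, forall i, i <= n -> beta a b i (f i).
Proof.
  assert (B : exists B, forall i, i <= n -> f i <= B).
  { induction n as [|n [B HB]]; [exists (f 0); intros i Hi; replace i with 0 by lia; lia|].
    exists (B + f (S n)). intros i Hi. destruct (Nat.eq_dec i (S n)) as [->|]; [lia|].
    specialize (HB i). lia. }
  destruct B as [B HB].
  set (b := fact n * S B). set (m := fun i => 1 + (i + 1) * b).
  assert (Hb : S B <= b) by (unfold b; assert (H := lt_O_fact n); nia).
  assert (Hc : forall i j, i < j < S n -> Nat.gcd (m j) (m i) = 1).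
  { intros i j Hij. set (g := Nat.gcd (m j) (m i)).
    assert (H1 : Nat.divide g (m j)) by apply Nat.gcd_divide_l.
    assert (H2 : Nat.divide g (m i)) by apply Nat.gcd_divide_r.
    assert (H3 : Nat.divide g (j - i)).
    { replace (j - i) with ((j + 1) * m i - (i + 1) * m j) by (unfold m; nia).
      apply Nat.divide_sub_r; apply Nat.divide_mul_r; assumption. }
    assert (H4 : Nat.divide g b).
    { apply Nat.divide_mul_l. eapply Nat.divide_trans; [exact H3|].
      apply divide_fact. lia. }
    apply Nat.divide_1_r. apply (Nat.divide_add_cancel_r g ((i + 1) * b)).
    - apply Nat.divide_mul_r, H4.
    - unfold m in H2. rewrite Nat.add_comm. exact H2. }
  destruct (chinese_remainder m f (S n)) as [a Ha]; [unfold m; lia|exact Hc|].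
  exists a, b. intros i Hi. specialize (HB i Hi).
  assert (Hf : f i < m i) by (unfold m; nia).
  split; [exact Hf|]. destruct (Ha i) as [q Hq]; [lia|].
  exists q. rewrite Nat.mod_small in Hq by exact Hf. exact Hq.
Qed.

Lemma beta_seq (a b : nat) (g : nat -> nat) k :
  beta a b 0 (g 0) ->
  (forall i, i < k -> beta a b i (g i) -> beta a b (i + 1) (g (S i))) ->
  beta a b k (g k).
Proof.
  intros H0 HS. induction k as [|k IH]; [exact H0|].
  assert (H : beta a b (k + 1) (g (S k))) by (apply HS; auto).
  rewrite Nat.add_1_r in H. exact H.
Qed.

Lemma exp_beta x y :
  (exists a b, beta a b 0 1 /\
     (forall i, i < x -> exists c, beta a b i c /\ beta a b (i + 1) (2 * c)) /\
     beta a b x y) <-> y = 2 ^ x.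
Proof.
  split.
  - intros (a & b & H0 & HS & Hx).
    apply (beta_fun a b x); [exact Hx|].
    apply (beta_seq a b (fun i => 2 ^ i)); [exact H0|].
    intros i Hi Hc. destruct (HS i Hi) as (c & H1 & H2).
    rewrite (beta_fun _ _ _ _ _ H1 Hc) in H2. exact H2.
  - intros ->. destruct (beta_exists (fun i => 2 ^ i) x) as (a & b & H).
    exists a, b. split; [apply (H 0); lia|]. split; [|apply H; lia].
    intros i Hi. exists (2 ^ i). split; [apply H; lia|].
    assert (H' := H (i + 1)). rewrite Nat.add_1_r in *. apply H'. lia.
Qed.

(** * Binary strings as numbers *)

Definition b2n (P : Prop) : nat :=
  if excluded_middle_informative P then 1 else 0.

Lemma b2n_le P : b2n P <= 1.
Proof. unfold b2n. destruct excluded_middle_informative; lia. Qed.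

Lemma b2n_inj P Q : b2n P = b2n Q -> (P <-> Q).
Proof.
  unfold b2n. do 2 destruct excluded_middle_informative; intros; tauto || lia.
Qed.

Lemma b2n_ext P Q : (P <-> Q) -> b2n P = b2n Q.
Proof. unfold b2n. do 2 destruct excluded_middle_informative; tauto. Qed.

(** The code of the initial segment of [H] of length [k]. *)
Fixpoint pre (H : nat -> Prop) (k : nat) : nat :=
  match k with 0 => 1 | S k => 2 * pre H k + b2n (H k) end.

Lemma pre_bounds H k : 2 ^ k <= pre H k < 2 * 2 ^ k.
Proof. induction k; simpl; [lia|]. assert (B := b2n_le (H k)). lia. Qed.

Lemma pre_pos H k : 0 < pre H k.
Proof. induction k; simpl; lia. Qed.

Lemma pre_agree H H' k : (forall p, p < k -> (H p <-> H' p)) -> pre H k = pre H' k.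
Proof.
  induction k as [|k IH]; simpl; intros A; [reflexivity|].
  rewrite IH by auto. rewrite (b2n_ext (H k) (H' k)) by auto. reflexivity.
Qed.

Lemma pre_inj H H' k k' :
  pre H k = pre H' k' -> k = k' /\ forall p, p < k -> (H p <-> H' p).
Proof.
  intros E.
  assert (Ek : k = k').
  { assert (B := pre_bounds H k). assert (B' := pre_bounds H' k'). rewrite E in B.
    destruct (Nat.lt_trichotomy k k') as [L|[L|L]]; [|exact L|];
      [apply (Nat.pow_le_mono_r 2 (S k)) in L|apply (Nat.pow_le_mono_r 2 (S k')) in L];
      simpl in L; lia. }
  split; [exact Ek|]. subst k'. induction k as [|k IH]; [lia|].
  simpl in E. assert (B := b2n_le (H k)). assert (B' := b2n_le (H' k)).
  intros p Hp. destruct (Nat.eq_dec p k) as [->|D].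
  - apply b2n_inj. lia.
  - apply IH; lia.
Qed.

Lemma string_pre t : 0 < t -> exists H k, t = pre H k.
Proof.
  induction t as [t IH] using lt_wf_ind. intros Ht.
  destruct (Nat.eq_dec t 1) as [->|D]; [exists (fun _ => False), 0; reflexivity|].
  assert (E := Nat.div_mod_eq t 2). assert (R := Nat.mod_upper_bound t 2).
  revert E R. generalize (t / 2) (t mod 2). intros q r E R.
  destruct (IH q) as (H & k & Hk); [lia|lia|].
  exists (fun p => p < k /\ H p \/ p = k /\ r = 1), (S k). simpl.
  rewrite (pre_agree _ H k) by (intros p Hp; assert (p <> k) by lia; tauto).
  rewrite <- Hk. unfold b2n.
  destruct excluded_middle_informative as [[[L _]|[_ Y]]|N]; [lia|lia|].
  assert (r <> 1) by tauto. lia.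
Qed.

Definition ext (s t : nat) : Prop :=
  0 < s /\ exists j r, r < 2 ^ j /\ t = s * 2 ^ j + r.

Lemma ext_pre H k k' : k <= k' -> ext (pre H k) (pre H k').
Proof.
  intros L. split; [apply pre_pos|]. replace k' with ((k' - k) + k) by lia.
  exists (k' - k). clear L. induction (k' - k) as [|j (r & Hr & E)]; simpl.
  - exists 0. lia.
  - exists (2 * r + b2n (H (j + k))). assert (B := b2n_le (H (j + k))).
    split; lia.
Qed.

Lemma ext_pre_inv H k H' k' :
  ext (pre H k) (pre H' k') -> k <= k' /\ forall p, p < k -> (H p <-> H' p).
Proof.
  intros (_ & j & r & Hr & E). revert k' r Hr E.
  induction j as [|j IH]; intros k' r Hr E; simpl in *.
  - destruct (pre_inj H H' k k') as [-> A]; [lia|]. split; [lia|exact A].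
  - assert (P := pre_pos H k). assert (P2 : 0 < 2 ^ j).
    { apply Nat.neq_0_lt_0, Nat.pow_nonzero. lia. }
    destruct k' as [|k']; simpl in E; [nia|].
    assert (B := b2n_le (H' k')). assert (D := Nat.div_mod_eq r 2).
    assert (R := Nat.mod_upper_bound r 2).
    destruct (IH k' (r / 2)) as [L A]; [lia|nia|].
    split; [lia|exact A].
Qed.

Lemma ext_string H k t :
  ext (pre H k) t -> exists H' k', t = pre H' k' /\ k <= k' /\
    forall p, p < k -> (H p <-> H' p).
Proof.
  intros E. assert (P := pre_pos H k).
  destruct (string_pre t) as (H' & k' & ->).
  { destruct E as (_ & j & r & _ & ->).
    assert (2 ^ j <> 0) by (apply Nat.pow_nonzero; lia). nia. }
  exists H', k'. split; [reflexivity|]. apply ext_pre_inv, E.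
Qed.

Lemma ext_pos s t : ext s t -> 0 < t.
Proof.
  intros [Hs E]. destruct (string_pre s Hs) as (H & k & ->).
  destruct (ext_string H k t) as (H' & k' & -> & _); [split; assumption|].
  apply pre_pos.
Qed.

Lemma ext_refl s : 0 < s -> ext s s.
Proof. intros P. destruct (string_pre s P) as (H & k & ->). now apply ext_pre. Qed.

Lemma ext_trans s t u : ext s t -> ext t u -> ext s u.
Proof.
  intros E F. destruct (string_pre s (proj1 E)) as (H & k & ->).
  destruct (ext_string _ _ _ E) as (H' & k' & -> & L & A).
  destruct (ext_string _ _ _ F) as (H'' & k'' & -> & L' & A').
  rewrite (pre_agree H H'' k); [apply ext_pre; lia|].
  intros p Hp. rewrite (A p) by lia. apply A'. lia.
Qed.

(** The initial segment of length [p] is a number [c] with [p + 1] binary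
    digits; bounding [c] by powers of 2 is what picks out the position. *)
Definition bit (b : bool) (t p : nat) : Prop :=
  exists c, 2 ^ p <= c /\ c < 2 * 2 ^ p /\ ext (2 * c + if b then 1 else 0) t.

Lemma bit_pre b H k p : bit b (pre H k) p <-> p < k /\ (b = true <-> H p).
Proof.
  split.
  - intros (c & L & U & E).
    destruct (string_pre c) as (F & q & ->); [assert (2 ^ p <> 0) by (apply Nat.pow_nonzero; lia); lia|].
    assert (Eq : q = p).
    { assert (B := pre_bounds F q).
      destruct (Nat.lt_trichotomy p q) as [K|[K|K]]; [|auto|];
      [apply (Nat.pow_le_mono_r 2 (S p)) in K|apply (Nat.pow_le_mono_r 2 (S q)) in K];
      simpl in K; lia. }
    subst q.
    replace (2 * pre F p + (if b then 1 else 0))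
      with (pre (fun x => x < p /\ F x \/ x = p /\ b = true) (S p)) in E.
    + apply ext_pre_inv in E. destruct E as [Lk A]. split; [lia|].
      rewrite <- (A p) by lia. intuition lia.
    + simpl. rewrite (pre_agree _ F p) by (intros x Hx; assert (x <> p) by lia; tauto).
      unfold b2n. destruct b, excluded_middle_informative; intuition (lia || discriminate).
  - intros [L E]. exists (pre H p). assert (B := pre_bounds H p).
    split; [lia|]. split; [lia|].
    replace (2 * pre H p + (if b then 1 else 0)) with (pre H (S p)).
    + apply ext_pre. lia.
    + simpl. unfold b2n. destruct b, excluded_middle_informative; intuition discriminate.
Qed.

Lemma bit_ext b s t p : ext s t -> bit b s p -> bit b t p.
Proof. intros E (c & L & U & F). exists c. split; [|split]; eauto using ext_trans. Qed.

Lemma bit_fun b b' t p : 0 < t -> bit b t p -> bit b' t p -> b = b'.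
Proof.
  intros P B B'. destruct (string_pre t P) as (H & k & ->).
  apply bit_pre in B, B'. destruct b, b'; intuition.
Qed.

(** The limit of a chain of strings may be taken to agree with any given set
    where the chain leaves it undefined. *)
Lemma chain_limit (t : nat -> nat) (G : nat -> Prop) :
  (forall n, ext (t n) (t (S n))) ->
  exists Y : nat -> Prop, (forall n, exists k, t n = pre Y k) /\
    forall p, (forall n b, ~ bit b (t n) p) -> (Y p <-> G p).
Proof.
  intros E.
  assert (M : forall n m, n <= m -> ext (t n) (t m)).
  { induction 1; [apply ext_refl, (E n)|]. eapply ext_trans; eauto. }
  exists (fun p => (exists n, bit true (t n) p) \/
                   G p /\ forall n b, ~ bit b (t n) p).
  split.
  - intros n. destruct (string_pre (t n)) as (H & k & Hk); [apply (E n)|].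
    exists k. rewrite Hk. apply pre_agree. intros p Hp.
    assert (B : forall b, (b = true <-> H p) -> bit b (t n) p).
    { intros b Hb. rewrite Hk. apply bit_pre. tauto. }
    split.
    + intros HH. left. exists n. apply B. tauto.
    + intros [[m Hm]|[_ N]].
      * apply NNPP. intros HH.
        assert (B0 : bit false (t n) p) by (apply B; intuition discriminate).
        assert (true = false); [|discriminate].
        apply (bit_fun _ _ (t (Nat.max n m)) p).
        -- eapply ext_pos. apply (M n). lia.
        -- apply (bit_ext _ (t m)); [apply M; lia|exact Hm].
        -- apply (bit_ext _ (t n)); [apply M; lia|exact B0].
      * destruct (classic (H p)) as [HH|HH]; [exact HH|].
        destruct (N n false). apply B. intuition discriminate.
  - intros p N. split; [intros [[n B]|[HG _]]; [destruct (N _ _ B)|exact HG]|].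
    auto.
Qed.

(** * Sigma1 conditions on sets *)

(** Sigma1 formulas built from literals: sets enter positively and negatively,
    but only through atoms, so that a true formula is already made true by
    finitely many membership facts. [SAll t p] is the bounded quantifier. *)
Inductive sf : Type :=
| SEq (t u : tm)
| SLt (t u : tm)
| SLit (b : bool) (X : nat) (t : tm)
| SAnd (p q : sf)
| SOr (p q : sf)
| SEx (p : sf)
| SAll (t : tm) (p : sf).

Definition lit (b : bool) (P : Prop) : Prop := b = true <-> P.

Fixpoint ssat (w : nat -> nat -> Prop) (e : nat -> nat) (p : sf) : Prop :=
  match p with
  | SEq t u => ev e t = ev e u
  | SLt t u => ev e t < ev e u
  | SLit b X t => lit b (w X (ev e t))
  | SAnd p q => ssat w e p /\ ssat w e q
  | SOr p q => ssat w e p \/ ssat w e q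
  | SEx p => exists a, ssat w (scons a e) p
  | SAll t p => forall a, a < ev e t -> ssat w (scons a e) p
  end.

Fixpoint ssub (s : nat -> tm) (p : sf) : sf :=
  match p with
  | SEq t u => SEq (subst_tm s t) (subst_tm s u)
  | SLt t u => SLt (subst_tm s t) (subst_tm s u)
  | SLit b X t => SLit b X (subst_tm s t)
  | SAnd p q => SAnd (ssub s p) (ssub s q)
  | SOr p q => SOr (ssub s p) (ssub s q)
  | SEx p => SEx (ssub (upN s) p)
  | SAll t p => SAll (subst_tm s t) (ssub (upN s) p)
  end.

Fixpoint srename (r : nat -> nat) (p : sf) : sf :=
  match p with
  | SEq t u => SEq t u
  | SLt t u => SLt t u
  | SLit b X t => SLit b (r X) t
  | SAnd p q => SAnd (srename r p) (srename r q)
  | SOr p q => SOr (srename r p) (srename r q)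
  | SEx p => SEx (srename r p)
  | SAll t p => SAll t (srename r p)
  end.

Fixpoint setvars_lt (N : nat) (p : sf) : Prop :=
  match p with
  | SEq _ _ | SLt _ _ => True
  | SLit _ X _ => X < N
  | SAnd p q | SOr p q => setvars_lt N p /\ setvars_lt N q
  | SEx p | SAll _ p => setvars_lt N p
  end.

Lemma ex_iff {A} (P Q : A -> Prop) :
  (forall a, P a <-> Q a) -> (exists a, P a) <-> (exists a, Q a).
Proof. firstorder. Qed.

Lemma ev_upN a e s :
  (fun i => ev (scons a e) (upN s i)) = scons a (fun i => ev e (s i)).
Proof. extensionality i. destruct i; [reflexivity|]. apply ev_lift1. Qed.

Lemma ssat_ssub w p : forall s e,
  ssat w e (ssub s p) <-> ssat w (fun i => ev e (s i)) p.
Proof.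
  induction p as [t u|t u|b X t|p IHp q IHq|p IHp q IHq|p IHp|t p IHp];
    intros s e; simpl; rewrite ?ev_subst; try reflexivity.
  - rewrite IHp, IHq. reflexivity.
  - rewrite IHp, IHq. reflexivity.
  - apply ex_iff. intros a. rewrite IHp, ev_upN. reflexivity.
  - apply all_iff. intros a. rewrite IHp, ev_upN. reflexivity.
Qed.

Lemma ssat_srename w r p : forall e,
  ssat w e (srename r p) <-> ssat (fun i => w (r i)) e p.
Proof.
  induction p as [t u|t u|b X t|p IHp q IHq|p IHp q IHq|p IHp|t p IHp];
    intros e; simpl; try reflexivity.
  - rewrite IHp, IHq. reflexivity.
  - rewrite IHp, IHq. reflexivity.
  - apply ex_iff. intros a. apply IHp.
  - apply all_iff. intros a. rewrite IHp. reflexivity.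
Qed.

Lemma ssat_agree N w w' p : setvars_lt N p -> (forall i, i < N -> w i = w' i) ->
  forall e, ssat w e p <-> ssat w' e p.
Proof.
  intros B A. induction p as [t u|t u|b X t|p IHp q IHq|p IHp q IHq|p IHp|t p IHp];
    intros e; simpl in *; try reflexivity.
  - rewrite A by exact B. reflexivity.
  - rewrite IHp, IHq by tauto. reflexivity.
  - rewrite IHp, IHq by tauto. reflexivity.
  - apply ex_iff. intros a. apply IHp, B.
  - apply all_iff. intros a. rewrite IHp by exact B. reflexivity.
Qed.

Lemma setvars_lt_mono N N' p : N <= N' -> setvars_lt N p -> setvars_lt N' p.
Proof. intros L. induction p; simpl; intuition lia. Qed.

Lemma setvars_lt_srename N N' r p :
  (forall i, i < N -> r i < N') -> setvars_lt N p -> setvars_lt N' (srename r p).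
Proof. intros H. induction p; simpl; intuition. Qed.

(** ** Arithmetical Sigma1 formulas *)

Fixpoint num (n : nat) : tm :=
  match n with 0 => Zero | S n => Add (num n) One end.

Lemma ev_num e n : ev e (num n) = n.
Proof. induction n; simpl; lia. Qed.

Definition Sbeta (a b i r : tm) : sf :=
  SAnd (SLt r (1 + (i + 1) * b))
    (SEx (SEq (lift 1 a)
       (Var 0 * (1 + (lift 1 i + 1) * lift 1 b) + lift 1 r))).

Definition Sexp (x y : tm) : sf :=
  SEx (SEx (SAnd (Sbeta (Var 1) (Var 0) 0 1)
    (SAnd (SAll (lift 2 x) (SEx (SAnd (Sbeta (Var 3) (Var 2) (Var 1) (Var 0))
              (Sbeta (Var 3) (Var 2) (Var 1 + 1) (2 * Var 0)))))
       (Sbeta (Var 1) (Var 0) (lift 2 x) (lift 2 y))))).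

Definition Sext (s t : tm) : sf :=
  SAnd (SLt 0 s)
    (SEx (SEx (SEx (SAnd (Sexp (Var 2) (Var 1)) (SAnd (SLt (Var 0) (Var 1))
       (SEq (lift 3 t) (lift 3 s * Var 1 + Var 0))))))).

Definition Sbit (b : bool) (t p : tm) : sf :=
  SEx (SEx (SAnd (Sexp (lift 2 p) (Var 0)) (SAnd (SLt (Var 0) (Var 1 + 1))
    (SAnd (SLt (Var 1) (2 * Var 0))
       (Sext (2 * Var 1 + if b then 1 else 0) (lift 2 t)))))).

Section SigmaConnectives.
Context (w : nat -> nat -> Prop) (e : nat -> nat).
Notation "'[' p ']'" := (ssat w e p).

Lemma ssat_Eq t u (m n : nat) : ev e t = m -> ev e u = n -> [SEq t u] <-> m = n.
Proof. intros <- <-. reflexivity. Qed.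

Lemma ssat_Lt t u (m n : nat) : ev e t = m -> ev e u = n -> [SLt t u] <-> m < n.
Proof. intros <- <-. reflexivity. Qed.

Lemma ssat_Lit b X t (m : nat) (A : nat -> Prop) :
  ev e t = m -> w X = A -> [SLit b X t] <-> lit b (A m).
Proof. intros <- <-. reflexivity. Qed.

Lemma ssat_Pos X t (m : nat) (A : nat -> Prop) :
  ev e t = m -> w X = A -> [SLit true X t] <-> A m.
Proof. intros <- <-. simpl. unfold lit. tauto. Qed.

Lemma ssat_NegLit X t (m : nat) (A : nat -> Prop) :
  ev e t = m -> w X = A -> [SLit false X t] <-> ~ A m.
Proof. intros <- <-. simpl. unfold lit. intuition discriminate. Qed.

Lemma ssat_And p q (P Q : Prop) : [p] <-> P -> [q] <-> Q -> [SAnd p q] <-> P /\ Q.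
Proof. simpl. tauto. Qed.

Lemma ssat_Or p q (P Q : Prop) : [p] <-> P -> [q] <-> Q -> [SOr p q] <-> P \/ Q.
Proof. simpl. tauto. Qed.

Lemma ssat_Ex p (P : nat -> Prop) :
  (forall a, ssat w (scons a e) p <-> P a) -> [SEx p] <-> exists a, P a.
Proof. apply ex_iff. Qed.

Lemma ssat_All t p (m : nat) (P : nat -> Prop) : ev e t = m ->
  (forall a, ssat w (scons a e) p <-> P a) ->
  [SAll t p] <-> forall a, a < m -> P a.
Proof. intros <- H. simpl. apply all_iff. intros a. rewrite H. reflexivity. Qed.
End SigmaConnectives.

Ltac ev_tac :=
  simpl; rewrite ?ev_lift1, ?ev_lift2, ?ev_lift3, ?ev_num; reflexivity.

(** Unfolds an [sf] formula, connective by connective, into the proposition on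
    the right of the equivalence to be proved. *)
Ltac ssat_step :=
  match goal with
  | |- ssat _ _ (SAnd _ _) <-> _ => apply ssat_And
  | |- ssat _ _ (SOr _ _) <-> _ => apply ssat_Or
  | |- ssat _ _ (SEx _) <-> _ => apply ssat_Ex; intro
  | |- ssat _ _ (SAll _ _) <-> _ => apply ssat_All; [ev_tac|intro]
  | |- ssat _ _ (SEq _ _) <-> _ => apply ssat_Eq; ev_tac
  | |- ssat _ _ (SLt _ _) <-> _ => apply ssat_Lt; ev_tac
  | |- ssat _ _ (SLit true _ _) <-> _ => apply ssat_Pos; [ev_tac|try reflexivity]
  | |- ssat _ _ (SLit false _ _) <-> _ =>
      apply ssat_NegLit; [ev_tac|try reflexivity]
  end.

Lemma ssat_beta w e a b i r (a' b' i' r' : nat) :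
  ev e a = a' -> ev e b = b' -> ev e i = i' -> ev e r = r' ->
  ssat w e (Sbeta a b i r) <-> beta a' b' i' r'.
Proof. intros <- <- <- <-. unfold Sbeta, beta. repeat ssat_step. Qed.

Lemma ssat_exp w e x y (x' y' : nat) : ev e x = x' -> ev e y = y' ->
  ssat w e (Sexp x y) <-> y' = 2 ^ x'.
Proof.
  intros <- <-. rewrite <- exp_beta. unfold Sexp.
  repeat first [ssat_step | apply ssat_beta; ev_tac].
Qed.

Lemma ssat_ext w e s t (s' t' : nat) : ev e s = s' -> ev e t = t' ->
  ssat w e (Sext s t) <-> ext s' t'.
Proof.
  intros <- <-. unfold Sext, ext.
  transitivity (0 < ev e s /\ exists j q r, q = 2 ^ j /\ r < q /\
                 ev e t = ev e s * q + r).
  - repeat first [ssat_step | apply ssat_exp; ev_tac].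
  - apply and_iff_compat_l, ex_iff. intros j. split.
    + intros (q & r & -> & L & E). exists r. auto.
    + intros (r & L & E). exists (2 ^ j), r. auto.
Qed.

Lemma ssat_bit w e b t p (t' p' : nat) : ev e t = t' -> ev e p = p' ->
  ssat w e (Sbit b t p) <-> bit b t' p'.
Proof.
  intros <- <-. unfold Sbit, bit.
  transitivity (exists c q, q = 2 ^ ev e p /\ q < c + 1 /\ c < 2 * q /\
                 ext (2 * c + if b then 1 else 0) (ev e t)).
  - repeat first [ssat_step | apply ssat_exp; ev_tac
                 | apply ssat_ext; [destruct b; ev_tac|ev_tac]].
  - apply ex_iff. intros c. split.
    + intros (q & -> & L & U & E). split; [lia|auto].
    + intros (L & U & E). exists (2 ^ ev e p). split; [reflexivity|]. split; [lia|auto].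
Qed.

(** ** Pairing and environments *)

Definition cpair (x y : nat) : nat := to_nat (x, y).

(** Every number codes an environment, by iterating the bijective pairing. *)
Fixpoint dec (z i : nat) : nat :=
  match i with 0 => fst (of_nat z) | S i => dec (snd (of_nat z)) i end.

Lemma cpair_inj x y x' y' : cpair x y = cpair x' y' -> x = x' /\ y = y'.
Proof. intros E. apply (to_nat_inj (x, y) (x', y')) in E. injection E. auto. Qed.

Lemma cpair_surj z : exists x y, z = cpair x y.
Proof.
  exists (fst (of_nat z)), (snd (of_nat z)). unfold cpair.
  rewrite <- surjective_pairing, cancel_to_of. reflexivity.
Qed.

Lemma dec_cpair x z : dec (cpair x z) = scons x (dec z).
Proof.
  extensionality i. unfold cpair. destruct i; cbn [dec scons]; rewrite cancel_of_to; reflexivity.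
Qed.

Lemma dec_exists (v : nat -> nat) n : exists z, forall i, i < n -> dec z i = v i.
Proof.
  revert v. induction n as [|n IH]; intros v; [exists 0; lia|].
  destruct (IH (fun i => v (S i))) as [z Hz]. exists (cpair (v 0) z).
  rewrite dec_cpair. intros [|i] L; simpl; [reflexivity|]. apply Hz. lia.
Qed.

Definition Spair (x y z : tm) : sf :=
  SEq (2 * z) (2 * y + (y + x) * (y + x + 1)).

Lemma ssat_pair w e x y z (x' y' z' : nat) :
  ev e x = x' -> ev e y = y' -> ev e z = z' ->
  ssat w e (Spair x y z) <-> z' = cpair x' y'.
Proof.
  intros <- <- <-. simpl. assert (E := to_nat_spec (ev e x) (ev e y)).
  fold (cpair (ev e x) (ev e y)) in E. lia.
Qed.

Fixpoint Sdec (z : tm) (i : nat) (n : tm) : sf :=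
  match i with
  | 0 => SEx (Spair (lift 1 n) (Var 0) (lift 1 z))
  | S i => SEx (SEx (SAnd (Spair (Var 1) (Var 0) (lift 2 z))
                          (Sdec (Var 0) i (lift 2 n))))
  end.

Lemma ssat_dec w i : forall e z n (z' n' : nat), ev e z = z' -> ev e n = n' ->
  ssat w e (Sdec z i n) <-> n' = dec z' i.
Proof.
  induction i as [|i IH]; intros e z n z' n' <- <-;
    destruct (cpair_surj (ev e z)) as (x & y & E).
  - transitivity (exists y, ev e z = cpair (ev e n) y).
    + unfold Sdec. repeat first [ssat_step|apply ssat_pair; ev_tac].
    + rewrite E, dec_cpair. simpl. split.
      * intros [y' F]. apply cpair_inj in F. symmetry. apply F.
      * intros ->. exists y. reflexivity.
  - transitivity (exists x y, ev e z = cpair x y /\ ev e n = dec y i).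
    + simpl Sdec. repeat first [ssat_step|apply ssat_pair; ev_tac].
      apply IH; ev_tac.
    + rewrite E, dec_cpair. simpl. split.
      * intros (x' & y' & F & G). apply cpair_inj in F. destruct F as [_ ->]. exact G.
      * intros G. eauto.
Qed.

Fixpoint Sval (t z n : tm) : sf :=
  match t with
  | Var i => Sdec z i n
  | Zero => SEq n 0
  | One => SEq n 1
  | Add t u => SEx (SEx (SAnd (Sval t (lift 2 z) (Var 1))
      (SAnd (Sval u (lift 2 z) (Var 0)) (SEq (lift 2 n) (Var 1 + Var 0)))))
  | Mul t u => SEx (SEx (SAnd (Sval t (lift 2 z) (Var 1))
      (SAnd (Sval u (lift 2 z) (Var 0)) (SEq (lift 2 n) (Var 1 * Var 0)))))
  end.

Lemma ssat_val w t : forall e z n (z' n' : nat), ev e z = z' -> ev e n = n' ->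
  ssat w e (Sval t z n) <-> n' = ev (dec z') t.
Proof.
  induction t as [i| | |t IHt u IHu|t IHt u IHu]; intros e z n z' n' <- <-; simpl Sval.
  - apply ssat_dec; reflexivity.
  - ssat_step.
  - ssat_step.
  - transitivity (exists a b, a = ev (dec (ev e z)) t /\ b = ev (dec (ev e z)) u /\
                   ev e n = a + b).
    + repeat ssat_step; [apply IHt|apply IHu]; ev_tac.
    + simpl. split; [intros (a & b & -> & -> & E)|]; eauto 6.
  - transitivity (exists a b, a = ev (dec (ev e z)) t /\ b = ev (dec (ev e z)) u /\
                   ev e n = a * b).
    + repeat ssat_step; [apply IHt|apply IHu]; ev_tac.
    + simpl. split; [intros (a & b & -> & -> & E)|]; eauto 6.
Qed.

Lemma setvars_lt_dec N i : forall z n, setvars_lt N (Sdec z i n).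
Proof. induction i; simpl; auto. Qed.

Lemma setvars_lt_val N t : forall z n, setvars_lt N (Sval t z n).
Proof. induction t; simpl; auto using setvars_lt_dec. Qed.

(** * Forcing a Sigma1 condition by an initial segment *)

(** A single set [H] stands for all sets with index [N] and above, so that
    information about these can be given by one finite string. The columns are
    cut out by the terms [M * x + c], since these belong to the language. *)
Definition blk (N M : nat) (w : nat -> nat -> Prop) (H : nat -> Prop)
    (i x : nat) : Prop :=
  if i <? N then w i x else H (M * x + (i - N)).

(** [p] is made true in [blk N M w H] by the information about [H] in [t].
    Because this is again a Sigma1 formula, now about [w] alone, forcing can
    occur in Pi2 conditions on further sets. *)
Fixpoint frc (N M : nat) (t : tm) (p : sf) : sf :=
  match p with
  | SEq u v => SEq u v
  | SLt u v => SLt u v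
  | SLit b X u =>
      if X <? N then SLit b X u else Sbit b t (num M * u + num (X - N))
  | SAnd p q => SAnd (frc N M t p) (frc N M t q)
  | SOr p q => SOr (frc N M t p) (frc N M t q)
  | SEx p => SEx (frc N M (lift 1 t) p)
  | SAll u p => SAll u (frc N M (lift 1 t) p)
  end.

Lemma setvars_lt_frc N M p : forall t, setvars_lt N (frc N M t p).
Proof.
  induction p as [| |b X u| | | |]; intros s; simpl; auto.
  destruct (Nat.ltb_spec X N); simpl; repeat split; auto.
Qed.

Lemma frc_lit N M t b X u w e (t' : nat) : ev e t = t' ->
  ssat w e (frc N M t (SLit b X u)) <->
  if X <? N then lit b (w X (ev e u)) else bit b t' (M * ev e u + (X - N)).
Proof.
  intros <-. simpl. destruct (Nat.ltb_spec X N); [reflexivity|].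
  apply ssat_bit; ev_tac.
Qed.

Lemma frc_sound N M w H k p : forall t e, ev e t = pre H k ->
  ssat w e (frc N M t p) -> ssat (blk N M w H) e p.
Proof.
  induction p as [u v|u v|b X u|p IHp q IHq|p IHp q IHq|p IHp|u p IHp];
    intros s e E; auto.
  - rewrite (frc_lit _ _ _ _ _ _ _ _ _ E). simpl. unfold blk.
    destruct (X <? N); [auto|]. intros B. apply bit_pre in B. apply B.
  - intros [Hp Hq]. split; eauto.
  - intros [Hp|Hq]; [left|right]; eauto.
  - intros [a Ha]. exists a. apply (IHp (lift 1 s)); [|exact Ha].
    rewrite ev_lift1. exact E.
  - intros Ha a L. apply (IHp (lift 1 s)); [|exact (Ha a L)].
    rewrite ev_lift1. exact E.
Qed.

(** By induction on [p]: only finitely many literals are used to make [p] true,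
    also below a bounded quantifier. *)
Lemma frc_complete N M w H p : forall e, ssat (blk N M w H) e p ->
  exists k0, forall k, k0 <= k -> forall t e', e' = e -> ev e t = pre H k ->
  ssat w e' (frc N M t p).
Proof.
  assert (L1 : forall e a t k, ev e t = pre H k ->
                 ev (scons a e) (lift 1 t) = pre H k).
  { intros. rewrite ev_lift1. assumption. }
  induction p as [u v|u v|b X u|p IHp q IHq|p IHp q IHq|p IHp|u p IHp]; intros e Hs.
  - exists 0. intros k _ t e' -> _. exact Hs.
  - exists 0. intros k _ t e' -> _. exact Hs.
  - exists (S (M * ev e u + (X - N))). intros k L t e' -> E.
    apply (frc_lit _ _ _ _ _ _ _ _ _ E).
    simpl in Hs. unfold blk in Hs. destruct (X <? N); [exact Hs|].
    apply bit_pre. split; [lia|exact Hs].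
  - destruct Hs as [Hp Hq].
    destruct (IHp e Hp) as [k1 H1], (IHq e Hq) as [k2 H2].
    exists (k1 + k2). intros k L t e' -> E.
    split; [eapply (H1 k)|eapply (H2 k)]; eauto; lia.
  - destruct Hs as [Hp|Hq].
    + destruct (IHp e Hp) as [k1 H1]. exists k1. intros k L t e' -> E.
      left. eapply (H1 k); eauto.
    + destruct (IHq e Hq) as [k1 H1]. exists k1. intros k L t e' -> E.
      right. eapply (H1 k); eauto.
  - destruct Hs as [a Ha]. destruct (IHp _ Ha) as [k1 H1]. exists k1.
    intros k L t e' -> E. exists a. eapply (H1 k); eauto.
  - assert (C : exists k0, forall a, a < ev e u -> forall k, k0 <= k ->
              forall t e', e' = scons a e -> ev (scons a e) t = pre H k ->
              ssat w e' (frc N M t p)).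
    { simpl in Hs. induction (ev e u) as [|n IH]; [exists 0; lia|].
      destruct IH as [k1 H1]; [auto|]. destruct (IHp _ (Hs n (Nat.lt_succ_diag_r n))) as [k2 H2].
      exists (k1 + k2). intros a La k Lk s e' -> E.
      destruct (Nat.eq_dec a n) as [->|D].
      - apply (H2 k ltac:(lia) s); auto.
      - apply (H1 a ltac:(lia) k ltac:(lia) s); auto. }
    destruct C as [k0 C]. exists k0. intros k L t e' -> E a La.
    eapply (C a La k); eauto.
Qed.

(** * Towers *)

Definition env1 (n : nat) : nat -> nat := scons n (fun _ => 0).

Definition Pi2 (p : sf) (w : nat -> nat -> Prop) : Prop :=
  forall n, ssat w (env1 n) p.

(** Each of the first [N] sets is the greatest solution of a parameter-free Pi2
    condition in which the sets before it are held fixed. Greatest, rather than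
    unique, solutions are needed to go beyond the hyperarithmetical sets, as
    Pi^1_1 comprehension requires; they are still rigid enough to defeat
    genericity. The condition may mention sets with larger index as long as
    greatestness holds whatever these are. *)
Definition Tower (N : nat) (w : nat -> nat -> Prop) : Prop :=
  forall j, j < N -> exists p, setvars_lt N p /\ Pi2 p w /\
    forall w', (forall i, i < j -> w' i = w i) -> Pi2 p w' ->
    forall x, w' j x -> w j x.

Definition upd (w : nat -> nat -> Prop) (N : nat) (A : nat -> Prop)
    (i : nat) : nat -> Prop :=
  if i =? N then A else w i.

Lemma upd_eq w N A : upd w N A N = A.
Proof. unfold upd. rewrite Nat.eqb_refl. reflexivity. Qed.

Lemma upd_lt w N A i : i < N -> upd w N A i = w i.
Proof. intros L. unfold upd. destruct (Nat.eqb_spec i N); [lia|reflexivity]. Qed.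

Lemma Pi2_agree N w w' p : setvars_lt N p -> (forall i, i < N -> w i = w' i) ->
  Pi2 p w -> Pi2 p w'.
Proof. intros B A H n. apply (ssat_agree N w w' p B A), H. Qed.

Lemma Tower_extend N w p A :
  Tower N w -> setvars_lt (S N) p -> Pi2 p (upd w N A) ->
  (forall A', Pi2 p (upd w N A') -> forall x, A' x -> A x) ->
  Tower (S N) (upd w N A).
Proof.
  intros T B HA G j Hj. destruct (Nat.eq_dec j N) as [->|D].
  - exists p. split; [exact B|]. split; [exact HA|]. intros w' Agr HP x.
    rewrite upd_eq. apply G.
    apply (Pi2_agree (S N) w' _ p B); [|exact HP]. intros i Hi.
    destruct (Nat.eq_dec i N) as [->|D]; [symmetry; apply upd_eq|].
    rewrite Agr by lia. rewrite !upd_lt by lia. reflexivity.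
  - destruct (T j) as (q & Bq & HP & Hq); [lia|]. exists q.
    split; [apply (setvars_lt_mono N); [lia|exact Bq]|].
    split; [apply (Pi2_agree N w); [exact Bq| |exact HP]; intros; now rewrite upd_lt|].
    intros w' Agr HP' x. rewrite upd_lt by lia. apply Hq; [|exact HP'].
    intros i Hi. rewrite Agr by exact Hi. apply upd_lt. lia.
Qed.

(** The set is the greatest [Y] such that [p] holds of every member of [Y]. *)
Lemma Tower_sigma N w p :
  Tower N w -> setvars_lt N p ->
  Tower (S N) (upd w N (fun x => ssat w (env1 x) p)).
Proof.
  intros T B.
  assert (E : forall A n, ssat (upd w N A) (env1 n) (SOr (SLit false N (Var 0)) p) <->
                ~ A n \/ ssat w (env1 n) p).
  { intros A n. apply ssat_Or.
    - apply ssat_NegLit; [reflexivity|apply upd_eq].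
    - apply (ssat_agree N); [exact B|]. intros i Hi. apply upd_lt, Hi. }
  apply (Tower_extend N w (SOr (SLit false N (Var 0)) p)).
  - exact T.
  - split; [simpl; lia|]. apply (setvars_lt_mono N); [lia|exact B].
  - intros n. apply E. apply NNPP; tauto.
  - intros A' HA x Hx. destruct (proj1 (E A' x) (HA x)); tauto.
Qed.

Lemma set_ext (A B : nat -> Prop) : (forall x, A x <-> B x) -> A = B.
Proof. intros H. extensionality x. apply propositional_extensionality, H. Qed.

(** Since the conditions in a tower have no parameters, towers can be put side
    by side; hence finitely many sets of the model lie in a common tower. *)
Lemma Tower_append N w N' w' : Tower N w -> Tower N' w' ->
  Tower (N + N') (fun i => if i <? N then w i else w' (i - N)).
Proof.
  intros T T' j Hj. destruct (Nat.ltb_spec j N) as [L|L].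
  - destruct (T j L) as (p & B & HP & G). exists p.
    split; [apply (setvars_lt_mono N); [lia|exact B]|]. split.
    + apply (Pi2_agree N w); [exact B| |exact HP]. intros i Hi.
      destruct (Nat.ltb_spec i N); [reflexivity|lia].
    + intros w2 Agr HP2. apply G; [|exact HP2]. intros i Hi.
      rewrite Agr by exact Hi. destruct (Nat.ltb_spec i N); [reflexivity|lia].
  - destruct (T' (j - N)) as (p & B & HP & G); [lia|].
    exists (srename (fun i => N + i) p). split.
    { apply (setvars_lt_srename N'); [intros; lia|exact B]. }
    split.
    + intros n. apply ssat_srename.
      apply (ssat_agree N' w'); [exact B| |apply HP]. intros i Hi.
      destruct (Nat.ltb_spec (N + i) N); [lia|]. f_equal. lia.
    + intros w2 Agr HP2 x Hx.
      apply (G (fun i => w2 (N + i))).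
      * intros i Hi. rewrite Agr by lia.
        destruct (Nat.ltb_spec (N + i) N); [lia|]. f_equal. lia.
      * intros n. apply ssat_srename, HP2.
      * replace (N + (j - N)) with j by lia. exact Hx.
Qed.

Definition InM (A : nat -> Prop) : Prop :=
  exists N w j, Tower N w /\ j < N /\ A = w j.

Lemma InM_tower (u : nat -> nat -> Prop) K : (forall i, InM (u i)) ->
  exists N w r, Tower N w /\ forall i, i < K -> r i < N /\ u i = w (r i).
Proof.
  intros Hu. induction K as [|K (N & w & r & T & Hr)].
  - exists 0, u, (fun i => i). split; intros j; lia.
  - destruct (Hu K) as (N' & w' & j & T' & Hj & E).
    exists (N + N'), (fun i => if i <? N then w i else w' (i - N)),
      (fun i => if i <? K then r i else N + j).
    split; [apply Tower_append; assumption|]. intros i Hi.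
    destruct (Nat.ltb_spec i K) as [L|L].
    + destruct (Hr i L) as [Lr Er]. split; [lia|].
      destruct (Nat.ltb_spec (r i) N); [exact Er|lia].
    + split; [lia|]. destruct (Nat.ltb_spec (N + j) N); [lia|].
      replace (N + j - N) with j by lia. replace i with K by lia. exact E.
Qed.

Lemma InM_sigma N w p : Tower N w -> setvars_lt N p ->
  InM (fun x => ssat w (env1 x) p).
Proof.
  intros T B. eexists (S N), _, N. split; [apply Tower_sigma; eassumption|].
  split; [lia|]. symmetry. apply upd_eq.
Qed.

(** * Arithmetical truth as a Pi2 system *)

Lemma Pi2_and p q w : Pi2 (SAnd p q) w <-> Pi2 p w /\ Pi2 q w.
Proof. unfold Pi2. simpl. firstorder. Qed.

Lemma define_set B p q (D : (nat -> nat -> Prop) -> nat -> Prop) :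
  setvars_lt B p -> setvars_lt B q ->
  (forall w z, ssat w (env1 z) p <-> D w z) ->
  (forall w z, ssat w (env1 z) q <-> ~ D w z) ->
  exists r, setvars_lt (S B) r /\ (forall w, Pi2 r (upd w B (D w))) /\
    forall w, Pi2 r w -> forall z, w B z <-> D w z.
Proof.
  intros Bp Bq Hp Hq.
  set (r := SOr (SAnd (SLit true B (Var 0)) p) (SAnd (SLit false B (Var 0)) q)).
  assert (E : forall w z,
    ssat w (env1 z) r <-> w B z /\ D w z \/ ~ w B z /\ ~ D w z).
  { intros w z. unfold r. repeat first [ssat_step | apply Hp | apply Hq]. }
  exists r. split; [|split].
  - simpl. repeat split; try (eapply setvars_lt_mono; [|eassumption]); lia.
  - intros w z. apply E. rewrite upd_eq.
    assert (D (upd w B (D w)) z <-> D w z).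
    { rewrite <- !Hp. apply (ssat_agree B); [exact Bp|]. intros. now apply upd_lt. }
    tauto.
  - intros w Hw z. specialize (Hw z). apply E in Hw. tauto.
Qed.

Definition Satom (t u : tm) (k : sf) : sf :=
  SEx (SEx (SAnd (Sval t (Var 2) (Var 1)) (SAnd (Sval u (Var 2) (Var 0)) k))).

Lemma ssat_atom w z t u k :
  ssat w (env1 z) (Satom t u k) <->
  ssat w (scons (ev (dec z) u) (scons (ev (dec z) t) (env1 z))) k.
Proof.
  transitivity (exists a b, a = ev (dec z) t /\ b = ev (dec z) u /\
                  ssat w (scons b (scons a (env1 z))) k).
  - unfold Satom. repeat ssat_step; try (apply ssat_val; ev_tac); reflexivity.
  - split; [intros (a & b & -> & -> & H); exact H|eauto].
Qed.

Lemma define_atom B t u k k' (P : (nat -> nat -> Prop) -> nat -> nat -> Prop) :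
  setvars_lt B k -> setvars_lt B k' ->
  (forall w e, ssat w e k <-> P w (e 1) (e 0)) ->
  (forall w e, ssat w e k' <-> ~ P w (e 1) (e 0)) ->
  exists r, setvars_lt (S B) r /\
    (forall w, exists w', (forall i, i < B -> w' i = w i) /\ Pi2 r w') /\
    forall w, Pi2 r w -> forall z,
      w B z <-> P w (ev (dec z) t) (ev (dec z) u).
Proof.
  intros Bk Bk' Hk Hk'.
  destruct (define_set B (Satom t u k) (Satom t u k')
    (fun w z => P w (ev (dec z) t) (ev (dec z) u))) as (r & Br & Hr & Ur).
  - simpl. auto using setvars_lt_val.
  - simpl. auto using setvars_lt_val.
  - intros w z. rewrite ssat_atom. apply Hk.
  - intros w z. rewrite ssat_atom. apply Hk'.
  - exists r. split; [exact Br|]. split; [|exact Ur]. intros w.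
    eexists. split; [|apply (Hr w)]. intros. now apply upd_lt.
Qed.

(** An arithmetical formula is equivalent to a Pi2 system with auxiliary sets,
    one for each subformula, holding the codes of the environments in which the
    subformula is true: each is tied to its immediate subformulas by a Pi2
    condition, even where there is a number quantifier. *)
Lemma arith_system U q : arithmetical q ->
  forall r B, (forall i, r i < B) -> exists B' y p,
    B <= y < B' /\ setvars_lt B' p /\
    (forall w, exists w', (forall i, i < B -> w' i = w i) /\ Pi2 p w') /\
    (forall w, Pi2 p w -> forall z,
       w y z <-> sat (std U) (dec z) (fun i => w (r i)) q).
Proof.
  induction q as [t u|t u|t X| |q1 IH1 q2 IH2|q IH|q _]; intros Aq r B Hr.
  - destruct (define_atom B t u (SEq (Var 1) (Var 0))
      (SOr (SLt (Var 1) (Var 0)) (SLt (Var 0) (Var 1))) (fun _ m n => m = n))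
      as (p & Bp & Ep & Up); try (simpl; intuition lia).
    exists (S B), B, p. split; [lia|]. do 2 (split; [assumption|]).
    intros w Hw z. rewrite (Up w Hw z). simpl. rewrite !eval_std. reflexivity.
  - destruct (define_atom B t u (SLt (Var 1) (Var 0))
      (SLt (Var 0) (Var 1 + 1)) (fun _ m n => m < n))
      as (p & Bp & Ep & Up); try (simpl; intuition lia).
    exists (S B), B, p. split; [lia|]. do 2 (split; [assumption|]).
    intros w Hw z. rewrite (Up w Hw z). simpl. rewrite !eval_std. reflexivity.
  - destruct (define_atom B t t (SLit true (r X) (Var 1))
      (SLit false (r X) (Var 1)) (fun w m _ => w (r X) m) (Hr X) (Hr X)
      (fun w e => ssat_Pos w e (r X) (Var 1) _ _ eq_refl eq_refl)
      (fun w e => ssat_NegLit w e (r X) (Var 1) _ _ eq_refl eq_refl))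
      as (p & Bp & Ep & Up).
    exists (S B), B, p. split; [lia|]. do 2 (split; [assumption|]).
    intros w Hw z. rewrite (Up w Hw z). simpl. rewrite !eval_std. reflexivity.
  - destruct (define_atom B 0 0 (SLt 0 0) (SEq 0 0) (fun _ m n => False))%L2
      as (p & Bp & Ep & Up); try (simpl; intuition lia).
    exists (S B), B, p. split; [lia|]. do 2 (split; [assumption|]).
    intros w Hw z. apply (Up w Hw z).
  - destruct Aq as [A1 A2].
    destruct (IH1 A1 r B Hr) as (B1 & y1 & p1 & L1 & S1 & E1 & U1).
    destruct (IH2 A2 r B1) as (B2 & y2 & p2 & L2 & S2 & E2 & U2).
    { intros i. specialize (Hr i). lia. }
    destruct (define_set B2
      (SOr (SLit false y1 (Var 0)) (SLit true y2 (Var 0)))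
      (SAnd (SLit true y1 (Var 0)) (SLit false y2 (Var 0)))
      (fun w z => w y1 z -> w y2 z)) as (p & Bp & Ep & Up).
    { simpl; lia. }
    { simpl; lia. }
    { intros w z. transitivity (~ w y1 z \/ w y2 z); [repeat ssat_step|].
      destruct (classic (w y1 z)); tauto. }
    { intros w z. transitivity (w y1 z /\ ~ w y2 z); [repeat ssat_step|].
      destruct (classic (w y1 z)); tauto. }
    exists (S B2), B2, (SAnd p1 (SAnd p2 p)).
    split; [lia|]. split; [|split].
    + simpl. repeat split; [| |exact Bp]; eapply setvars_lt_mono; try eassumption; lia.
    + intros w. destruct (E1 w) as (w1 & Agr1 & P1). destruct (E2 w1) as (w2 & Agr2 & P2).
      eexists. split; [|rewrite !Pi2_and; split; [|split; [|apply (Ep w2)]]].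
      * intros i Hi. rewrite upd_lt by lia. rewrite Agr2 by lia. auto.
      * apply (Pi2_agree B1 w1); [exact S1| |exact P1]. intros i Hi.
        rewrite upd_lt by lia. symmetry. auto.
      * apply (Pi2_agree B2 w2); [exact S2| |exact P2]. intros i Hi.
        rewrite upd_lt by lia. reflexivity.
    + intros w Hw z. rewrite !Pi2_and in Hw. destruct Hw as (H1 & H2 & H3).
      rewrite (Up w H3 z). rewrite (U1 w H1 z), (U2 w H2 z). reflexivity.
  - destruct (IH Aq r B Hr) as (B1 & y1 & p1 & L1 & S1 & E1 & U1).
    set (pa := SOr (SLit true y1 (Var 0)) (SEx (SEx
      (SAnd (Spair (Var 1) (Var 0) (Var 2)) (SLit false B1 (Var 0)))))).
    set (pb := SOr (SLit true B1 (Var 0)) (SEx (SEx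
      (SAnd (Spair (Var 1) (Var 2) (Var 0)) (SLit false y1 (Var 0)))))).
    assert (Ea : forall w n, ssat w (env1 n) pa <->
      w y1 n \/ exists a z, n = cpair a z /\ ~ w B1 z).
    { intros w n. unfold pa. repeat first [ssat_step|apply ssat_pair; ev_tac]. }
    assert (Eb : forall w z, ssat w (env1 z) pb <->
      w B1 z \/ exists a n, n = cpair a z /\ ~ w y1 n).
    { intros w n. unfold pb. repeat first [ssat_step|apply ssat_pair; ev_tac]. }
    exists (S B1), B1, (SAnd p1 (SAnd pa pb)).
    split; [lia|]. split; [|split].
    + simpl. repeat split; try lia. eapply setvars_lt_mono; [|eassumption]. lia.
    + intros w. destruct (E1 w) as (w1 & Agr1 & P1).
      exists (upd w1 B1 (fun z => forall a, w1 y1 (cpair a z))).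
      split; [intros i Hi; rewrite upd_lt by lia; auto|].
      rewrite !Pi2_and. split; [|split].
      * apply (Pi2_agree B1 w1); [exact S1| |exact P1]. intros i Hi.
        rewrite upd_lt by lia. reflexivity.
      * intros n. apply Ea. rewrite upd_eq, upd_lt by lia.
        destruct (classic (w1 y1 n)) as [Y|Y]; [auto|right].
        destruct (cpair_surj n) as (a & z & ->). exists a, z. auto.
      * intros z. apply Eb. rewrite upd_eq, upd_lt by lia.
        apply NNPP. intros C. apply C. left. intros a. apply NNPP. intros Y.
        apply C. right. eauto.
    + intros w Hw z. rewrite !Pi2_and in Hw. destruct Hw as (H1 & H2 & H3).
      simpl. transitivity (forall a, w y1 (cpair a z)).
      * split.
        -- intros Y a. destruct (proj1 (Ea w _) (H2 (cpair a z))) as [D|(a' & z' & E & D)];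
             [exact D|]. apply cpair_inj in E. destruct E as [_ ->]. contradiction.
        -- intros Y. destruct (proj1 (Eb w z) (H3 z)) as [D|(a & n & -> & D)];
             [exact D|]. destruct (D (Y a)).
      * apply all_iff. intros a. rewrite (U1 w H1), dec_cpair. reflexivity.
  - destruct Aq.
Qed.

(** ** Sets of finite strings with a solution above them *)

Definition inst (n : tm) (p : sf) : sf := ssub (scons n (fun _ => Zero)) p.

Definition forces N M w p (n t : nat) : Prop :=
  ssat w (fun _ => 0) (frc N M (num t) (inst (num n) p)).

Lemma frc_ssub N M w p : forall s s' t t' e e', ev e t = ev e' t' ->
  (forall i, ev e (s i) = ev e' (s' i)) ->
  ssat w e (frc N M t (ssub s p)) <-> ssat w e' (frc N M t' (ssub s' p)).
Proof.
  assert (U : forall s s' e e' a, (forall i, ev e (s i) = ev e' (s' i)) ->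
    forall i, ev (scons a e) (upN s i) = ev (scons a e') (upN s' i)).
  { intros s s' e e' a H [|i]; simpl; [reflexivity|]. rewrite !ev_lift1. apply H. }
  assert (E : forall s s' e e' u, (forall i, ev e (s i) = ev e' (s' i)) ->
    ev e (subst_tm s u) = ev e' (subst_tm s' u)).
  { intros s s' e e' u H. induction u; simpl; auto. }
  induction p as [u v|u v|b X u|p IHp q IHq|p IHp q IHq|p IHp|u p IHp];
    intros s s' t t' e e' Et Es.
  - simpl. rewrite !(E s s' e e') by assumption. reflexivity.
  - simpl. rewrite !(E s s' e e') by assumption. reflexivity.
  - simpl ssub. rewrite (frc_lit _ _ _ _ _ _ _ _ _ Et), (frc_lit _ _ _ _ _ _ _ _ _ eq_refl).
    rewrite (E s s' e e') by assumption. reflexivity.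
  - simpl. rewrite (IHp s s' t t' e e'), (IHq s s' t t' e e') by assumption. reflexivity.
  - simpl. rewrite (IHp s s' t t' e e'), (IHq s s' t t' e e') by assumption. reflexivity.
  - simpl. apply ex_iff. intros a. apply IHp; [|auto]. rewrite !ev_lift1. exact Et.
  - simpl. apply all_iff. intros a. rewrite (E s s' e e') by assumption.
    apply imp_iff_compat_l. apply IHp; [|auto]. rewrite !ev_lift1. exact Et.
Qed.

Lemma ssat_forces N M w w' e p n t (n' t' : nat) :
  (forall i, i < N -> w i = w' i) -> ev e n = n' -> ev e t = t' ->
  ssat w e (frc N M t (inst n p)) <-> forces N M w' p n' t'.
Proof.
  intros A <- <-. unfold forces. rewrite (ssat_agree N w w') by (apply setvars_lt_frc || exact A).
  apply frc_ssub; [rewrite ev_num; reflexivity|].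
  intros [|i]; simpl; [rewrite ev_num|]; reflexivity.
Qed.

Lemma ssat_inst w e n p : ssat w e (inst n p) <-> ssat w (env1 (ev e n)) p.
Proof.
  unfold inst. rewrite ssat_ssub.
  replace (fun i => ev e (scons n (fun _ => Zero) i)) with (env1 (ev e n));
    [reflexivity|]. extensionality i. destruct i; reflexivity.
Qed.

Lemma forces_sound N M w p n H k :
  forces N M w p n (pre H k) -> ssat (blk N M w H) (env1 n) p.
Proof.
  intros F. apply (frc_sound _ _ _ H k) in F; [|apply ev_num].
  apply ssat_inst in F. rewrite ev_num in F. exact F.
Qed.

Lemma forces_complete N M w p n H :
  ssat (blk N M w H) (env1 n) p ->
  exists k0, forall k, k0 <= k -> forces N M w p n (pre H k).
Proof.
  intros F.
  destruct (frc_complete N M w H (inst (num n) p) (fun _ => 0)) as [k0 C].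
  - apply ssat_inst. rewrite ev_num. exact F.
  - exists k0. intros k L. apply (C k L); [reflexivity|apply ev_num].
Qed.

Definition solvable N M w p (s : nat) : Prop :=
  exists H k, s = pre H k /\ Pi2 p (blk N M w H).

Definition step N M w p (A : nat -> Prop) (s n t : nat) : Prop :=
  ext s t /\ A t /\ forces N M w p n t.

Definition Sstep N M p (s n t : tm) : sf :=
  SAnd (Sext s t) (SAnd (SLit true N t) (frc N M t (inst n p))).

Lemma ssat_Sstep N M w w' p A e s n t (s' n' t' : nat) :
  (forall i, i < N -> w i = w' i) -> w N = A ->
  ev e s = s' -> ev e n = n' -> ev e t = t' ->
  ssat w e (Sstep N M p s n t) <-> step N M w' p A s' n' t'.
Proof.
  intros Agr HA Es En Et. unfold Sstep. apply ssat_And; [apply ssat_ext; assumption|].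
  apply ssat_And; [apply ssat_Pos; assumption|]. apply ssat_forces; assumption.
Qed.

Lemma solvable_step N M w p s n : solvable N M w p s ->
  exists t, step N M w p (solvable N M w p) s n t.
Proof.
  intros (H & k & -> & HP).
  destruct (forces_complete N M w p n H (HP n)) as [k0 F].
  exists (pre H (k + k0)). split; [apply ext_pre; lia|].
  split; [exists H, (k + k0); auto|apply F; lia].
Qed.

Lemma chain_exists (A : nat -> Prop) (R : nat -> nat -> nat -> Prop) s :
  A s -> (forall s n, A s -> exists t, A t /\ R s n t) ->
  exists c : nat -> nat, c 0 = s /\ forall n, R (c n) n (c (S n)).
Proof.
  intros As HR.
  destruct (constructive_indefinite_description
    (fun f : nat -> nat -> nat => forall s n, A s -> A (f s n) /\ R s n (f s n)))
    as [f Hf].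
  { exists (fun s n => epsilon (inhabits 0) (fun t => A t /\ R s n t)).
    intros s' n As'. apply epsilon_spec, HR, As'. }
  set (c := fix c n := match n with 0 => s | S n => f (c n) n end).
  assert (Ac : forall n, A (c n)).
  { induction n as [|n IH]; [exact As|]. apply Hf, IH. }
  exists c. split; [reflexivity|]. intros n. apply Hf, Ac.
Qed.

(** A chain which forces the instances one after the other forces all of them. *)
Lemma chain_solution N M w p A c Y :
  (forall n, step N M w p A (c n) n (c (S n))) ->
  (forall n, exists k, c n = pre Y k) -> Pi2 p (blk N M w Y).
Proof.
  intros Hc HY n. destruct (HY (S n)) as [k E].
  apply (forces_sound N M w p n Y k). rewrite <- E. apply Hc.
Qed.

(** That every member of [A] has, for every [n], an extension in [A] forcing
    instance [n] is a Pi2 condition on [A], and any such [A] consists of strings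
    which extend to solutions. *)
Lemma Tower_solvable N M w p :
  Tower N w -> Tower (S N) (upd w N (solvable N M w p)).
Proof.
  intros T.
  set (q := SEx (SEx (SAnd (Spair (Var 1) (Var 0) (Var 2))
    (SOr (SLit false N (Var 1)) (SEx (Sstep N M p (Var 2) (Var 1) (Var 0))))))).
  assert (E : forall A m, ssat (upd w N A) (env1 m) q <->
    exists s n, m = cpair s n /\ (~ A s \/ exists t, step N M w p A s n t)).
  { intros A m. unfold q.
    repeat first [ssat_step|apply ssat_pair; ev_tac|apply upd_eq
      |apply ssat_Sstep; [apply upd_lt|apply upd_eq|ev_tac..]]. }
  apply (Tower_extend N w q).
  - exact T.
  - simpl. repeat split; try lia. eapply setvars_lt_mono; [|apply setvars_lt_frc]. lia.
  - intros m. apply E. destruct (cpair_surj m) as (s & n & ->).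
    exists s, n. split; [reflexivity|].
    destruct (classic (solvable N M w p s)) as [Hs|Hs]; [right|auto].
    apply solvable_step, Hs.
  - intros A HA s0 As0.
    assert (HS : forall s n, A s -> exists t, step N M w p A s n t).
    { intros s n As. destruct (proj1 (E A _) (HA (cpair s n))) as (s' & n' & F & C).
      apply cpair_inj in F. destruct F as [-> ->]. tauto. }
    destruct (chain_exists A (step N M w p A) s0 As0) as (c & <- & Hc).
    { intros s n As. destruct (HS s n As) as [t Ht]. exists t. split; [apply Ht|exact Ht]. }
    destruct (chain_limit c (fun _ => False)) as (Y & HY & _); [intros n; apply Hc|].
    destruct (HY 0) as [k Ek]. exists Y, k. split; [exact Ek|].
    apply (chain_solution N M w p A c); assumption.
Qed.

(** * The basis theorem *)

Definition Smem2 (b : bool) (X : nat) (x y : tm) : sf :=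
  SEx (SAnd (Spair (lift 1 x) (lift 1 y) (Var 0)) (SLit b X (Var 0))).

Definition Smem3 (b : bool) (X : nat) (x y z : tm) : sf :=
  SEx (SAnd (Spair (lift 1 y) (lift 1 z) (Var 0)) (Smem2 b X (lift 1 x) (Var 0))).

Lemma ssat_mem2 w e b X x y (x' y' : nat) A :
  ev e x = x' -> ev e y = y' -> w X = A ->
  ssat w e (Smem2 b X x y) <-> lit b (A (cpair x' y')).
Proof.
  intros <- <- <-.
  transitivity (exists c, c = cpair (ev e x) (ev e y) /\ lit b (w X c)).
  - unfold Smem2. repeat first [ssat_step|apply ssat_pair; ev_tac].
    apply ssat_Lit; reflexivity.
  - split; [intros (c & -> & H); exact H|eauto].
Qed.

Lemma ssat_mem3 w e b X x y z (x' y' z' : nat) A :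
  ev e x = x' -> ev e y = y' -> ev e z = z' -> w X = A ->
  ssat w e (Smem3 b X x y z) <-> lit b (A (cpair x' (cpair y' z'))).
Proof.
  intros <- <- <- <-.
  transitivity (exists c, c = cpair (ev e y) (ev e z) /\
                  lit b (w X (cpair (ev e x) c))).
  - unfold Smem3. repeat first [ssat_step|apply ssat_pair; ev_tac].
    apply ssat_mem2; ev_tac.
  - split; [intros (c & -> & H); exact H|eauto].
Qed.

Lemma lit_true P : lit true P <-> P.
Proof. unfold lit. tauto. Qed.

Lemma lit_false P : lit false P <-> ~ P.
Proof. unfold lit. intuition discriminate. Qed.

Lemma least_exists (P : nat -> Prop) : (exists n, P n) ->
  exists n, P n /\ forall m, m < n -> ~ P m.
Proof.
  intros [n Hn]. revert Hn. induction n as [n IH] using lt_wf_ind. intros Hn.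
  destruct (classic (exists m, m < n /\ P m)) as [(m & L & Hm)|N].
  - apply (IH m L Hm).
  - exists n. split; [exact Hn|]. intros m L Hm. apply N. eauto.
Qed.

(** Extending a solvable string step by step by the least possible string gives
    a solution whose construction can be followed inside the tower. *)
Lemma solution_InM N M w p s : Tower N w -> solvable N M w p s ->
  exists H, InM H /\ (exists k, s = pre H k) /\ Pi2 p (blk N M w H).
Proof.
  intros T Hs. set (V := solvable N M w p).
  assert (T1 : Tower (S N) (upd w N V)) by (apply Tower_solvable; exact T).
  set (w1 := upd w N V) in *.
  (* the graph of the relation [step] *)
  set (pF := SEx (SEx (SEx (SEx
    (SAnd (Spair (Var 3) (Var 2) (Var 4)) (SAnd (Spair (Var 1) (Var 0) (Var 2))
      (Sstep N M p (Var 3) (Var 1) (Var 0)))))))).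
  assert (T2 := Tower_sigma (S N) w1 pF T1).
  set (F := fun x => ssat w1 (env1 x) pF) in *.
  assert (HF : forall s n t, F (cpair s (cpair n t)) <-> step N M w p V s n t).
  { intros s' n t. transitivity (exists a c b d, cpair s' (cpair n t) = cpair a c /\
      c = cpair b d /\ step N M w p V a b d).
    - unfold F, pF. repeat first [ssat_step|apply ssat_pair; ev_tac
        |apply ssat_Sstep; [apply upd_lt|apply upd_eq|ev_tac..]].
    - split; [|eauto 8]. intros (a & c & b & d & E1 & E2 & D). subst c.
      apply cpair_inj in E1. destruct E1 as [-> E1].
      apply cpair_inj in E1. destruct E1 as [-> ->]. exact D. }
  assert (T2' : Tower (S (S N)) (upd w1 (S N) F)).
  { apply T2. simpl. repeat split; try lia. eapply setvars_lt_mono; [|apply setvars_lt_frc]. lia. }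
  clear T2. set (w2 := upd w1 (S N) F) in *.
  set (R := fun s n t => step N M w p V s n t /\ forall t', t' < t -> ~ step N M w p V s n t').
  destruct (chain_exists V R s Hs) as (c & Ec & Hc).
  { intros s' n Vs'. destruct (least_exists _ (solvable_step N M w p s' n Vs')) as (t & Ht & Lt).
    exists t. split; [apply Ht|]. split; assumption. }
  (* the graph of the chain [c], which obeys a recursion in [F] *)
  set (L := fun x => exists n, x = cpair n (c n)).
  set (pL := SOr (SLit false (S (S N)) (Var 0)) (SEx (SEx
    (SAnd (Spair (Var 1) (Var 0) (Var 2)) (SOr
      (SAnd (SEq (Var 1) 0) (SEq (Var 0) (num s)))
      (SEx (SEx (SAnd (SEq (Var 3) (Var 1 + 1))
        (SAnd (Smem2 true (S (S N)) (Var 1) (Var 0))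
        (SAnd (Smem3 true (S N) (Var 0) (Var 1) (Var 2))
          (SAll (Var 2) (Smem3 false (S N) (Var 1) (Var 2) (Var 0))))))))))))).
  assert (EL : forall A x, ssat (upd w2 (S (S N)) A) (env1 x) pL <->
    ~ A x \/ exists n t, x = cpair n t /\
      (n = 0 /\ t = s \/ exists m t', n = m + 1 /\ A (cpair m t') /\ R t' m t)).
  { intros A x. transitivity (~ A x \/ exists n t, x = cpair n t /\
      (n = 0 /\ t = s \/ exists m t', n = m + 1 /\ lit true (A (cpair m t')) /\
        lit true (F (cpair t' (cpair m t))) /\
        forall a, a < t -> lit false (F (cpair t' (cpair m a))))).
    - unfold pL. repeat first [ssat_step|apply ssat_pair; ev_tac|apply upd_eq
        |apply ssat_mem2; [ev_tac..|apply upd_eq]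
        |apply ssat_mem3; [ev_tac..|rewrite upd_lt by lia; apply upd_eq]].
    - apply or_iff_compat_l. do 2 (apply ex_iff; intros ?). apply and_iff_compat_l.
      apply or_iff_compat_l. do 2 (apply ex_iff; intros ?). apply and_iff_compat_l.
      unfold R. rewrite !lit_true, HF. apply and_iff_compat_l, and_iff_compat_l.
      apply all_iff. intros t'. rewrite lit_false, HF. reflexivity. }
  assert (T3 : Tower (S (S (S N))) (upd w2 (S (S N)) L)).
  { apply (Tower_extend _ w2 pL); [exact T2'|simpl; repeat split; lia| |].
    - intros x. apply EL. destruct (classic (L x)) as [[n ->]|NL]; [right|auto].
      exists n, (c n). split; [reflexivity|]. destruct n as [|n]; [auto|right].
      exists n, (c n). split; [lia|]. split; [exists n; reflexivity|apply Hc].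
    - intros A HA.
      assert (U : forall n t, A (cpair n t) -> t = c n).
      { induction n as [n IH] using lt_wf_ind. intros t At.
        destruct (proj1 (EL A _) (HA (cpair n t))) as [D|(n' & t' & E & D)]; [contradiction|].
        apply cpair_inj in E. destruct E as [<- <-].
        destruct D as [[-> ->]|(m & t' & -> & Am & St & Lt)]; [congruence|].
        apply IH in Am; [subst t'|lia]. rewrite Nat.add_1_r.
        destruct (Hc m) as [St' Lt'].
        destruct (Nat.lt_trichotomy t (c (S m))) as [C|[C|C]]; [|exact C|].
        - destruct (Lt' _ C St).
        - destruct (Lt _ C St'). }
      intros x Ax. destruct (cpair_surj x) as (n & t & ->).
      exists n. rewrite (U n t Ax). reflexivity. }
  destruct (chain_limit c (fun _ => False)) as (Y & HY & NY); [intros n; apply Hc|].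
  exists Y. split; [|split].
  - set (pY := SEx (SEx (SAnd (Smem2 true (S (S N)) (Var 1) (Var 0))
                             (Sbit true (Var 0) (Var 2))))).
    assert (HI := InM_sigma _ _ pY T3).
    replace Y with (fun x => ssat (upd w2 (S (S N)) L) (env1 x) pY).
    + apply HI. simpl. repeat split; lia.
    + apply set_ext. intros x.
      transitivity (exists n t, lit true (L (cpair n t)) /\ bit true t x).
      * unfold pY. repeat first [ssat_step|apply ssat_bit; ev_tac
          |apply ssat_mem2; [ev_tac..|apply upd_eq]].
      * split.
        -- intros (n & t & Ln & B). apply (proj1 (lit_true _)) in Ln. destruct Ln as [n' E].
           apply cpair_inj in E. destruct E as [<- ->].
           destruct (HY n) as [k Ek]. rewrite Ek in B. apply bit_pre in B. tauto.
        -- intros Yx. apply NNPP. intros C. apply (NY x); [|exact Yx].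
           intros n b B. apply C. exists n, (c n). rewrite lit_true.
           split; [exists n; reflexivity|].
           assert (B' := B). destruct (HY n) as [k Ek]. rewrite Ek in B'.
           apply bit_pre in B'. destruct b; [exact B|]. intuition discriminate.
  - destruct (HY 0) as [k Ek]. exists k. congruence.
  - apply (chain_solution N M w p V c); [intros n; apply Hc|exact HY].
Qed.

(** ** The Pi2 system of an arithmetical formula with parameters in the model *)

Fixpoint tm_bound (t : tm) : nat :=
  match t with
  | Var i => S i
  | Zero | One => 0
  | Add t u | Mul t u => Nat.max (tm_bound t) (tm_bound u)
  end.

Fixpoint fm_bound (p : fm) : nat :=
  match p with
  | Eq t u | Lt t u => Nat.max (tm_bound t) (tm_bound u)
  | Mem t X => Nat.max (tm_bound t) (S X)
  | Bot => 0
  | Imp p q => Nat.max (fm_bound p) (fm_bound q)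
  | AllNum p | AllSet p => fm_bound p
  end.

Lemma ev_agree t : forall v v',
  (forall i, i < tm_bound t -> v i = v' i) -> ev v t = ev v' t.
Proof.
  induction t; intros v v' A; simpl in *; auto.
  - rewrite (IHt1 v v'), (IHt2 v v'); auto; intros; apply A; lia.
  - rewrite (IHt1 v v'), (IHt2 v v'); auto; intros; apply A; lia.
Qed.

Lemma scons_agree {A} (a : A) f g n :
  (forall i, i < n -> f i = g i) -> forall i, i < n -> scons a f i = scons a g i.
Proof. intros H [|i] L; simpl; [reflexivity|]. apply H. lia. Qed.

Lemma sat_agree S p : forall v v' w w',
  (forall i, i < fm_bound p -> v i = v' i) ->
  (forall i, i < fm_bound p -> w i = w' i) ->
  sat (std S) v w p <-> sat (std S) v' w' p.
Proof.
  induction p as [t u|t u|t X| |p IHp q IHq|p IHp|p IHp]; intros v v' w w' Av Aw;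
    simpl in *; rewrite ?eval_std.
  - rewrite (ev_agree t v v'), (ev_agree u v v') by (intros; apply Av; lia). reflexivity.
  - rewrite (ev_agree t v v'), (ev_agree u v v') by (intros; apply Av; lia). reflexivity.
  - rewrite (ev_agree t v v') by (intros; apply Av; lia). rewrite Aw by lia. reflexivity.
  - reflexivity.
  - rewrite (IHp v v' w w'), (IHq v v' w w') by (intros; apply Av || apply Aw; lia).
    reflexivity.
  - apply all_iff. intros a. apply IHp; [|exact Aw]. apply scons_agree, Av.
  - apply all_iff. intros X. apply imp_iff_compat_l. apply IHp; [exact Av|].
    apply scons_agree, Aw.
Qed.

Lemma div_mod_block M c x : c < M -> (M * x + c) / M = x /\ (M * x + c) mod M = c.
Proof.
  intros L. split.
  - symmetry. apply (Nat.div_unique _ _ _ c); lia.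
  - symmetry. apply (Nat.mod_unique _ _ x); lia.
Qed.

(** The numbers [y] and [z] locate, in the join [H] of [X] with its truth sets,
    the bit which tells whether [q] holds of [X] and the number [x]. *)
Lemma solution_system S q u v : arithmetical q -> (forall i, InM (u i)) ->
  exists N w M p y z, Tower N w /\
    (forall X : nat -> Prop, exists H : nat -> Prop,
       Pi2 p (blk N M w H) /\ forall x, H (M * x) <-> X x) /\
    (forall H, Pi2 p (blk N M w H) -> forall x,
       H (M * cpair x z + y) <->
       sat (std S) (scons x v) (scons (fun x => H (M * x)) u) q).
Proof.
  intros Aq Hu. set (K := fm_bound q).
  destruct (InM_tower u K Hu) as (N & w & r & T & Hr).
  set (r' := scons N (fun i => if i <? K then r i else N)).
  destruct (arith_system S q Aq r' (N + 1)) as (B & y & p & Ly & Bp & Ep & Up).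
  { intros [|i]; simpl; [lia|]. destruct (Nat.ltb_spec i K) as [L|L]; [|lia].
    apply Hr in L. lia. }
  destruct (dec_exists v K) as [z Hz].
  exists N, w, (B - N), p, (y - N), z. split; [exact T|]. split.
  - intros X. destruct (Ep (upd w N X)) as (w' & Agr & HP).
    exists (fun n => w' (N + n mod (B - N)) (n / (B - N))). split.
    + apply (Pi2_agree B w'); [exact Bp| |exact HP]. intros i Hi.
      apply set_ext. intros x. unfold blk. destruct (Nat.ltb_spec i N) as [L|L].
      * rewrite Agr, upd_lt by lia. reflexivity.
      * destruct (div_mod_block (B - N) (i - N) x) as [-> ->]; [lia|].
        replace (N + (i - N)) with i by lia. reflexivity.
    + intros x. destruct (div_mod_block (B - N) 0 x) as [E1 E2]; [lia|].
      rewrite Nat.add_0_r in E1, E2. rewrite E1, E2, Nat.add_0_r, Agr, upd_eq by lia.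
      reflexivity.
  - intros H HP x. assert (E := Up _ HP (cpair x z)). unfold blk at 1 in E.
    destruct (Nat.ltb_spec y N) as [L|L]; [lia|]. rewrite E, dec_cpair.
    apply sat_agree.
    + apply scons_agree, Hz.
    + intros [|i] Li; apply set_ext; intros x'; unfold blk; simpl.
      * rewrite Nat.ltb_irrefl, Nat.sub_diag, Nat.add_0_r. reflexivity.
      * destruct (Nat.ltb_spec i K) as [Lk|Lk]; [|unfold K in Lk; lia].
        destruct (Hr i Lk) as [Lr ->]. destruct (Nat.ltb_spec (r i) N); [reflexivity|lia].
Qed.

Lemma InM_column H M : InM H -> InM (fun x => H (M * x)).
Proof.
  intros (N & w & j & T & Lj & ->).
  assert (HI := InM_sigma N w (SLit true j (num M * Var 0)) T Lj).
  eapply eq_ind; [exact HI|]. apply set_ext. intros x.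
  apply ssat_Pos; [ev_tac|reflexivity].
Qed.

(** The model is a beta-model: an arithmetical condition on [X] becomes a Pi2
    condition on the join of [X] with truth sets, and if this has a solution at
    all then it has one in the model. The string [pre H (1 + m)] is long enough
    to record that the formula itself is true. *)
Lemma InM_basis S q u v : arithmetical q -> (forall i, InM (u i)) ->
  (exists X, sat (std S) v (scons X u) q) ->
  exists X, InM X /\ sat (std S) v (scons X u) q.
Proof.
  intros Aq Hu [X HX].
  assert (Ev : exists a v', v = scons a v').
  { exists (v 0), (fun i => v (1 + i)). extensionality i. destruct i; reflexivity. }
  destruct Ev as (a & v' & ->).
  destruct (solution_system S q u v' Aq Hu) as (N & w & M & p & y & z & T & Ep & Up).
  destruct (Ep X) as (H & HP & EX). set (m := M * cpair a z + y).
  assert (Hm : H m).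
  { apply (Up H HP). replace (fun x => H (M * x)) with X; [exact HX|].
    apply set_ext. intros x. symmetry. apply EX. }
  destruct (solution_InM N M w p (pre H (1 + m)) T) as (H' & I' & [k Ek] & HP').
  { exists H, (1 + m). auto. }
  exists (fun x => H' (M * x)). split; [apply InM_column, I'|].
  apply (Up H' HP'). apply pre_inj in Ek. destruct Ek as [_ A].
  apply A; [lia|exact Hm].
Qed.

(** Comprehension for Pi^1_1 formulas with the set quantifier ranging over all
    sets of numbers: a witness of the negation exists iff some solvable string
    has a certain entry equal to 1. *)
Lemma InM_comprehension U q u v : arithmetical q -> (forall i, InM (u i)) ->
  InM (fun x => forall X, sat (std U) (scons x v) (scons X u) q).
Proof.
  intros Aq Hu.
  destruct (solution_system U (Neg q) u v) as (N & w & M & p & y & z & T & Ep & Up);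
    [simpl; auto|exact Hu|].
  assert (T1 := Tower_solvable N M w p T).
  set (E := SEx (SEx (SAnd (Spair (Var 2) (num z) (Var 1))
    (SAnd (SLit true N (Var 0)) (Sbit true (Var 0) (num M * Var 1 + num y)))))).
  assert (T2 := Tower_sigma _ _ E T1). specialize (T2 ltac:(simpl; repeat split; lia)).
  assert (HI := InM_sigma _ _ (SLit false (S N) (Var 0)) T2 (Nat.lt_succ_diag_r _)).
  eapply eq_ind; [exact HI|]. clear HI. apply set_ext. intros x.
  rewrite (ssat_NegLit _ (env1 x) (S N) (Var 0) x _ eq_refl (upd_eq _ _ _)).
  transitivity (~ exists n s, n = cpair x z /\ solvable N M w p s /\ bit true s (M * n + y)).
  { apply not_iff_compat. unfold E.
    repeat first [ssat_step|apply ssat_pair; ev_tac|apply upd_eq|apply ssat_bit; ev_tac]. }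
  split.
  - intros NE X. apply NNPP. intros HX. apply NE.
    destruct (Ep X) as (H & HP & EX). set (m := M * cpair x z + y).
    exists (cpair x z), (pre H (1 + m)). split; [reflexivity|].
    split; [exists H, (1 + m); auto|]. apply bit_pre. split; [lia|].
    split; [intros _|auto]. apply (Up H HP).
    replace (fun x => H (M * x)) with X; [exact HX|].
    apply set_ext. intros x'. symmetry. apply EX.
  - intros HX (n & s & -> & (H & k & -> & HP) & B).
    apply bit_pre in B. destruct B as [_ [B _]]. specialize (B eq_refl).
    apply (Up H HP) in B. apply B, HX.
Qed.

(** * Bounded formulas and their codes *)

Inductive bf : Type :=
| BEq (t u : tm)
| BLt (t u : tm)
| BMem (t : tm)
| BNeg (f : bf)
| BAnd (f g : bf)
| BEx (t : tm) (f : bf).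

Fixpoint bsat (T : nat -> Prop) (e : nat -> nat) (f : bf) : Prop :=
  match f with
  | BEq t u => ev e t = ev e u
  | BLt t u => ev e t < ev e u
  | BMem t => T (ev e t)
  | BNeg f => ~ bsat T e f
  | BAnd f g => bsat T e f /\ bsat T e g
  | BEx t f => exists a, a < ev e t /\ bsat T (scons a e) f
  end.

Fixpoint bsubst (s : nat -> tm) (f : bf) : bf :=
  match f with
  | BEq t u => BEq (subst_tm s t) (subst_tm s u)
  | BLt t u => BLt (subst_tm s t) (subst_tm s u)
  | BMem t => BMem (subst_tm s t)
  | BNeg f => BNeg (bsubst s f)
  | BAnd f g => BAnd (bsubst s f) (bsubst s g)
  | BEx t f => BEx (subst_tm s t) (bsubst (upN s) f)
  end.

Lemma bsat_bsubst T f : forall s e e', (fun i => ev e (s i)) = e' ->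
  bsat T e (bsubst s f) <-> bsat T e' f.
Proof.
  induction f as [t u|t u|t|f IH|f IHf g IHg|t f IH]; intros s e e' <-; simpl;
    rewrite ?ev_subst; try reflexivity.
  - apply not_iff_compat, IH. reflexivity.
  - rewrite (IHf s e), (IHg s e) by reflexivity. reflexivity.
  - apply ex_iff. intros a. apply and_iff_compat_l, IH, ev_upN.
Qed.

Ltac scons_tac :=
  let i := fresh "i" in extensionality i; destruct i as [|[|[|i]]]; reflexivity.

(** The witnesses of a Sigma1 formula, also those below a bounded quantifier,
    are bounded by a single number. *)
Lemma sigma_bounded p : exists f, forall T e,
  ssat (fun _ => T) e p <-> exists w, bsat T (scons w e) f.
Proof.
  induction p as [t u|t u|b X t|p [f Hf] q [g Hg]|p [f Hf] q [g Hg]|p [f Hf]|t p [f Hf]].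
  - exists (BEq (lift 1 t) (lift 1 u)). intros T e. simpl.
    setoid_rewrite ev_lift1. split; [exists 0; assumption|intros [_ H]; exact H].
  - exists (BLt (lift 1 t) (lift 1 u)). intros T e. simpl.
    setoid_rewrite ev_lift1. split; [exists 0; assumption|intros [_ H]; exact H].
  - exists (if b then BMem (lift 1 t) else BNeg (BMem (lift 1 t))). intros T e.
    destruct b; simpl; setoid_rewrite ev_lift1; [rewrite lit_true|rewrite lit_false];
      (split; [exists 0; assumption|intros [_ H]; exact H]).
  - exists (BEx (Var 0) (BEx (Var 1)
      (BAnd (bsubst (scons (Var 1) (fun i => Var (3 + i))) f)
            (bsubst (scons (Var 0) (fun i => Var (3 + i))) g)))).
    intros T e. cbn [ssat bsat]. rewrite Hf, Hg. split.
    + intros [[a Ha] [b Hb]]. exists (1 + a + b), a. split; [simpl; lia|].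
      exists b. split; [simpl; lia|].
      split; [eapply bsat_bsubst; [|exact Ha]|eapply bsat_bsubst; [|exact Hb]]; scons_tac.
    + intros (w & a & _ & b & _ & Ha & Hb).
      split; [exists a|exists b]; (eapply bsat_bsubst; [|eassumption]); scons_tac.
  - exists (BNeg (BAnd (BNeg f) (BNeg g))).
    intros T e. cbn [ssat bsat]. rewrite Hf, Hg. split.
    + intros [[a Ha]|[a Ha]]; exists a; tauto.
    + intros [a Ha]. apply NNPP. intros N. apply Ha.
      split; intros C; apply N; [left|right]; exists a; exact C.
  - exists (BEx (Var 0) (BEx (Var 1)
      (bsubst (scons (Var 1) (scons (Var 0) (fun i => Var (3 + i)))) f))).
    intros T e. cbn [ssat bsat]. split.
    + intros [a Ha]. apply Hf in Ha. destruct Ha as [b Hb].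
      exists (1 + a + b), b. split; [simpl; lia|]. exists a. split; [simpl; lia|].
      eapply bsat_bsubst; [|exact Hb]. scons_tac.
    + intros (w & b & _ & a & _ & H). exists a. apply Hf. exists b.
      eapply bsat_bsubst; [|exact H]. scons_tac.
  - exists (BNeg (BEx (lift 1 t) (BNeg (BEx (Var 1)
      (bsubst (scons (Var 0) (scons (Var 1) (fun i => Var (3 + i)))) f))))).
    intros T e. cbn [ssat bsat].
    assert (B : forall w a b, bsat T (scons b (scons a (scons w e)))
      (bsubst (scons (Var 0) (scons (Var 1) (fun i => Var (3 + i)))) f) <->
      bsat T (scons b (scons a e)) f).
    { intros w a b. apply bsat_bsubst. scons_tac. }
    setoid_rewrite B. setoid_rewrite Hf. setoid_rewrite ev_lift1. split.
    + intros H.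
      assert (C : exists w, forall a, a < ev e t ->
                exists b, b < w /\ bsat T (scons b (scons a e)) f).
      { clear B. induction (ev e t) as [|n IH]; [exists 0; lia|].
        destruct IH as [w Hw]; [intros a L; apply H; lia|].
        destruct (H n) as [b Hb]; [lia|]. exists (1 + w + b). intros a L.
        destruct (Nat.eq_dec a n) as [->|D]; [exists b; split; [lia|exact Hb]|].
        destruct (Hw a) as (b' & Lb & Hb'); [lia|]. exists b'. split; [lia|exact Hb']. }
      destruct C as [w C]. exists w. intros (a & L & N). apply N, C, L.
    + intros [w H] a L. apply NNPP. intros N. apply H. exists a. split; [exact L|].
      intros (b & _ & Hb). apply N. exists b. exact Hb.
Qed.

(** ** The satisfaction classes *)

Definition np (s t : nat) : nat := (s + t) * (s + t) + s.

Lemma np_inj s t s' t' : np s t = np s' t' -> s = s' /\ t = t'.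
Proof.
  unfold np. intros E.
  destruct (Nat.lt_trichotomy (s + t) (s' + t')) as [L|[L|L]]; nia.
Qed.

Definition val_class (V : nat -> Prop) : Prop := forall x s n,
  V (np x (np s n)) <->
  (x = np 0 0 /\ exists z, s = np n z) \/
  (exists i y s', x = np 0 (i + 1) /\ s = np y s' /\ V (np (np 0 i) (np s' n))) \/
  (x = np 1 0 /\ n = 0) \/
  (x = np 2 0 /\ n = 1) \/
  (exists y z m l, V (np y (np s m)) /\ V (np z (np s l)) /\
     ((x = np 3 (np y z) /\ n = m + l) \/ (x = np 4 (np y z) /\ n = m * l))).

Lemma sat_ValClass U v w V :
  sat (std U) v w (ValClass V) <-> val_class (w V).
Proof.
  unfold ValClass, val_class, Val. repeat sat_step; ev_tac.
Qed.

(** The clauses of Tarski's definition, with [Z] the truth of the immediate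
    subformulas. *)
Definition sat_clauses (T V : nat -> Prop) (Z : nat -> nat -> Prop) (f s : nat) : Prop :=
  (exists x y m n, V (np x (np s m)) /\ V (np y (np s n)) /\
     ((f = np 0 (np x y) /\ m = n) \/ (f = np 1 (np x y) /\ m < n))) \/
  (exists x m, f = np 2 x /\ V (np x (np s m)) /\ T m) \/
  (exists g, f = np 3 g /\ ~ Z g s) \/
  (exists g h, f = np 4 (np g h) /\ Z g s /\ Z h s) \/
  (exists x g m z, f = np 5 (np x g) /\ V (np x (np s m)) /\ z < m /\ Z g (np z s)).

Definition sat_class (T V Z : nat -> Prop) : Prop := forall f s,
  Z (np f s) <-> sat_clauses T V (fun g s => Z (np g s)) f s.

Lemma sat_SatClass U v w T V Z :
  sat (std U) v w (SatClass T V Z) <-> sat_class (w T) (w V) (w Z).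
Proof.
  unfold SatClass, sat_class, sat_clauses, Val, Sat. repeat sat_step; ev_tac.
Qed.

Inductive value : nat -> nat -> nat -> Prop :=
| value_var0 n z : value (np 0 0) (np n z) n
| value_varS i y s n : value (np 0 i) s n -> value (np 0 (i + 1)) (np y s) n
| value_zero s : value (np 1 0) s 0
| value_one s : value (np 2 0) s 1
| value_add y z s m l : value y s m -> value z s l -> value (np 3 (np y z)) s (m + l)
| value_mul y z s m l : value y s m -> value z s l -> value (np 4 (np y z)) s (m * l).

Lemma val_class_exists : exists V, val_class V.
Proof.
  exists (fun q => exists x s n, q = np x (np s n) /\ value x s n).
  assert (E : forall x s n, (exists x' s' n', np x (np s n) = np x' (np s' n') /\
                value x' s' n') <-> value x s n).
  { intros x s n. split; [|eauto 6]. intros (x' & s' & n' & E & H).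
    apply np_inj in E. destruct E as [-> E]. apply np_inj in E.
    destruct E as [-> ->]. exact H. }
  intros x s n. rewrite E. setoid_rewrite E. split.
  - intros []; eauto 10.
    + right; right; right; right. exists y, z, m, l. auto.
    + right; right; right; right. exists y, z, m, l. auto.
  - intros [(-> & z & ->)|[(i & y & s' & -> & -> & H)|[(-> & ->)|[(-> & ->)|
      (y & z & m & l & Hy & Hz & [(-> & ->)|(-> & ->)])]]]]; constructor; assumption.
Qed.

Lemma sat_clauses_agree T V Z Z' f s :
  (forall g s, g < f -> (Z g s <-> Z' g s)) ->
  sat_clauses T V Z f s <-> sat_clauses T V Z' f s.
Proof.
  intros A. unfold sat_clauses.
  apply or_iff_compat_l, or_iff_compat_l.
  assert (L3 : forall g, g < np 3 g) by (unfold np; nia).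
  assert (L4 : forall g h, g < np 4 (np g h) /\ h < np 4 (np g h)) by (unfold np; nia).
  assert (L5 : forall g h, h < np 5 (np g h)) by (unfold np; nia).
  assert (O : forall P Q P' Q' : Prop, (P <-> P') -> (Q <-> Q') ->
    (P \/ Q <-> P' \/ Q')) by tauto.
  apply O; [|apply O].
  - apply ex_iff. intros g. split; intros [-> H]; (split; [reflexivity|]);
      intros C; apply H, A; auto.
  - apply ex_iff. intros g. apply ex_iff. intros h. destruct (L4 g h).
    split; intros (-> & H1 & H2); (split; [reflexivity|]); split; apply A; auto.
  - do 4 (apply ex_iff; intros ?).
    split; intros (-> & H1 & H2 & H3); (split; [reflexivity|]); do 2 (split; [assumption|]);
      apply A; auto.
Qed.

(** Numbers which are not codes of formulas also have a truth value, so [Z] is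
    defined by recursion on all numbers, with [k] as fuel. *)
Lemma sat_class_exists T V : exists Z, sat_class T V Z.
Proof.
  set (Z := fix Z k f s := match k with
              | 0 => False | S k => sat_clauses T V (Z k) f s end).
  assert (E : forall k f s, f < k -> (Z k f s <-> Z (S f) f s)).
  { induction k as [k IH] using lt_wf_ind. intros f s L. destruct k as [|k]; [lia|].
    simpl. apply sat_clauses_agree. intros g s' Lg.
    destruct (Nat.eq_dec f k) as [->|D]; [reflexivity|].
    rewrite (IH k), (IH f) by lia. reflexivity. }
  exists (fun q => exists f s, q = np f s /\ Z (S f) f s).
  assert (P : forall f s, (exists f' s', np f s = np f' s' /\ Z (S f') f' s') <->
                Z (S f) f s).
  { intros f s. split; [|eauto]. intros (f' & s' & F & H).
    apply np_inj in F. destruct F as [-> ->]. exact H. }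
  intros f s. rewrite P. simpl Z at 1. apply sat_clauses_agree. intros g s' L.
  rewrite P. apply E, L.
Qed.

Fixpoint code_tm (t : tm) : nat :=
  match t with
  | Var i => np 0 i
  | Zero => np 1 0
  | One => np 2 0
  | Add t u => np 3 (np (code_tm t) (code_tm u))
  | Mul t u => np 4 (np (code_tm t) (code_tm u))
  end.

Fixpoint code (f : bf) : nat :=
  match f with
  | BEq t u => np 0 (np (code_tm t) (code_tm u))
  | BLt t u => np 1 (np (code_tm t) (code_tm u))
  | BMem t => np 2 (code_tm t)
  | BNeg f => np 3 (code f)
  | BAnd f g => np 4 (np (code f) (code g))
  | BEx t f => np 5 (np (code_tm t) (code f))
  end.

Ltac np_inv :=
  repeat match goal with
  | H : np _ _ = np _ _ |- _ => apply np_inj in H; destruct H as [? H]; try discriminate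
  | H : _ /\ _ |- _ => destruct H
  | H : exists _, _ |- _ => destruct H
  | H : _ \/ _ |- _ => destruct H
  end; subst; try lia.

Section Truth.
Context (T V Z : nat -> Prop) (HV : val_class V) (HZ : sat_class T V Z).

Lemma V_zero c n : V (np (np 1 0) (np c n)) <-> n = 0.
Proof. rewrite (HV (np 1 0) c n). split; intros H; np_inv; auto. Qed.

Lemma V_one c n : V (np (np 2 0) (np c n)) <-> n = 1.
Proof. rewrite (HV (np 2 0) c n). split; intros H; np_inv; auto 6. Qed.

Lemma V_add y z c n : V (np (np 3 (np y z)) (np c n)) <->
  exists m l, V (np y (np c m)) /\ V (np z (np c l)) /\ n = m + l.
Proof.
  rewrite (HV (np 3 (np y z)) c n). split; intros H; [np_inv; eauto|].
  destruct H as (m & l & Hm & Hl & E). do 4 right. exists y, z, m, l. auto.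
Qed.

Lemma V_mul y z c n : V (np (np 4 (np y z)) (np c n)) <->
  exists m l, V (np y (np c m)) /\ V (np z (np c l)) /\ n = m * l.
Proof.
  rewrite (HV (np 4 (np y z)) c n). split; intros H; [np_inv; eauto|].
  destruct H as (m & l & Hm & Hl & E). do 4 right. exists y, z, m, l. auto.
Qed.

Lemma V_varS i y c n :
  V (np (np 0 (S i)) (np (np y c) n)) <-> V (np (np 0 i) (np c n)).
Proof.
  rewrite (HV (np 0 (S i)) (np y c) n). split; intros H.
  - np_inv. replace i with x by lia. assumption.
  - right; left. exists i, y, c. rewrite Nat.add_1_r. auto.
Qed.

Definition has_value (t : tm) (c m : nat) : Prop :=
  forall n, V (np (code_tm t) (np c n)) <-> n = m.

Lemma has_value_zero c : has_value Zero c 0.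
Proof. intros n. apply V_zero. Qed.

Lemma has_value_var0 y c : has_value (Var 0) (np y c) y.
Proof.
  intros n. simpl. rewrite (HV (np 0 0) (np y c) n). split; intros H; np_inv.
  left. split; [reflexivity|]. eauto.
Qed.

Lemma has_value_lift t y c m : has_value t c m -> has_value (lift 1 t) (np y c) m.
Proof.
  assert (E : forall n, V (np (code_tm (lift 1 t)) (np (np y c) n)) <->
                V (np (code_tm t) (np c n))).
  { induction t as [i| | |t IHt u IHu|t IHt u IHu]; intros n.
    - apply V_varS.
    - simpl. rewrite !V_zero. reflexivity.
    - simpl. rewrite !V_one. reflexivity.
    - simpl in *. rewrite !V_add. setoid_rewrite IHt. setoid_rewrite IHu. reflexivity.
    - simpl in *. rewrite !V_mul. setoid_rewrite IHt. setoid_rewrite IHu. reflexivity. }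
  intros H n. rewrite E. apply H.
Qed.

Lemma has_value_subst t s c d : (forall i, has_value (s i) c (d i)) ->
  has_value (subst_tm s t) c (ev d t).
Proof.
  intros Hs. induction t as [i| | |t IHt u IHu|t IHt u IHu]; intros n.
  - apply Hs.
  - apply V_zero.
  - apply V_one.
  - simpl. rewrite V_add. unfold has_value in IHt, IHu. setoid_rewrite IHt. setoid_rewrite IHu.
    split; [intros (m & l & -> & -> & E); exact E|eauto].
  - simpl. rewrite V_mul. unfold has_value in IHt, IHu. setoid_rewrite IHt. setoid_rewrite IHu.
    split; [intros (m & l & -> & -> & E); exact E|eauto].
Qed.

(** A variable beyond the length of a coded environment has no value, so codes
    are evaluated after a substitution of terms that do have one. *)
Lemma truth f : forall s c d, (forall i, has_value (s i) c (d i)) ->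
  Z (np (code (bsubst s f)) c) <-> bsat T d f.
Proof.
  induction f as [t u|t u|t|f IH|f IHf g IHg|t f IH]; intros s c d Hs;
    assert (Ht := fun t => has_value_subst t s c d Hs); simpl; rewrite (HZ _ c); unfold sat_clauses.
  - split; intros H; np_inv.
    + apply Ht in H, H0. congruence.
    + left. do 4 eexists. split; [apply Ht; reflexivity|]. split; [apply Ht; reflexivity|].
      auto.
  - split; intros H; np_inv.
    + apply Ht in H, H0. congruence.
    + left. do 4 eexists. split; [apply Ht; reflexivity|]. split; [apply Ht; reflexivity|].
      auto.
  - split; intros H; np_inv.
    + apply Ht in H0. congruence.
    + right; left. do 2 eexists. split; [reflexivity|]. split; [apply Ht; reflexivity|]. auto.
  - rewrite <- (IH s c d Hs). split; intros H; np_inv; [assumption|].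
    right; right; left. eauto.
  - rewrite <- (IHf s c d Hs), <- (IHg s c d Hs). split; intros H; np_inv; [auto|].
    right; right; right; left. eauto 6.
  - assert (Hup : forall a i, has_value (upN s i) (np a c) (scons a d i)).
    { intros a [|i]; [apply has_value_var0|]. apply has_value_lift, Hs. }
    split; intros H.
    + np_inv. apply Ht in H0. exists x2. split; [congruence|].
      apply (IH (upN s) (np x2 c)); [apply Hup|assumption].
    + destruct H as (a & L & H). right; right; right; right.
      do 2 eexists. exists (ev d t), a. split; [reflexivity|].
      split; [apply Ht; reflexivity|]. split; [exact L|]. apply (IH _ _ (scons a d)); auto.
Qed.

Lemma truth3 f : exists n, forall b a s,
  Z (np n (np b (np a (np s 0)))) <-> bsat T (scons b (scons a (env1 s))) f.
Proof.
  set (r := scons (Var 0) (scons (Var 1) (scons (Var 2) (fun _ => Zero)))).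
  exists (code (bsubst r f)). intros b a s. apply truth.
  intros [|[|[|i]]]; simpl.
  - apply has_value_var0.
  - apply (has_value_lift (Var 0)), has_value_var0.
  - apply (has_value_lift (Var 1)), (has_value_lift (Var 0)), has_value_var0.
  - apply has_value_zero.
Qed.
End Truth.

(** * The join of a tower is not generic *)

Definition sigma2 (T : nat -> Prop) (f : bf) (s : nat) : Prop :=
  s <> 0 /\ exists a, forall b, bsat T (scons b (scons a (env1 s))) f.

Definition meets_or_avoids (T G : nat -> Prop) (D : nat -> Prop) : Prop :=
  exists k, D (pre G k) \/ forall t, T t -> ext (pre G k) t -> ~ D t.

(** The Sigma1 witness of [p] becomes the inner universal quantifier of a Sigma2
    condition. *)
Lemma generic_not_sigma T G p :
  (forall f, meets_or_avoids T G (sigma2 T f)) ->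
  meets_or_avoids T G
    (fun s => exists a, ~ ssat (fun _ => T) (scons a (env1 s)) p).
Proof.
  intros Gen. destruct (sigma_bounded p) as [f Hf].
  assert (E : forall s, sigma2 T (BNeg f) s <->
    s <> 0 /\ exists a, ~ ssat (fun _ => T) (scons a (env1 s)) p).
  { intros s. apply and_iff_compat_l, ex_iff. intros a. rewrite Hf. simpl.
    split; [intros H [b Hb]; exact (H b Hb)|intros H b Hb; apply H; eauto]. }
  destruct (Gen (BNeg f)) as [k Hk]. exists k. destruct Hk as [Hk|Hk].
  - left. apply E, Hk.
  - right. intros t Tt Xt C. apply (Hk t Tt Xt), E. split; [|exact C].
    apply ext_pos in Xt. lia.
Qed.

Lemma generic_sigma T G p :
  (forall f, meets_or_avoids T G (sigma2 T f)) ->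
  meets_or_avoids T G (fun s => ssat (fun _ => T) (env1 s) p).
Proof.
  intros Gen. destruct (sigma_bounded p) as [f Hf].
  (* the witness is taken by the outer quantifier, variable 1; the inner one is
     vacuous *)
  set (f' := bsubst (scons (Var 1) (fun i => Var (2 + i))) f).
  assert (E : forall s, sigma2 T f' s <-> s <> 0 /\ ssat (fun _ => T) (env1 s) p).
  { intros s. apply and_iff_compat_l. rewrite Hf. apply ex_iff. intros a.
    assert (B : forall b, bsat T (scons b (scons a (env1 s))) f' <->
                  bsat T (scons a (env1 s)) f).
    { intros b. apply bsat_bsubst. scons_tac. }
    setoid_rewrite B. split; [intros H; exact (H 0)|auto]. }
  destruct (Gen f') as [k Hk]. exists k. destruct Hk as [Hk|Hk].
  - left. apply E, Hk.
  - right. intros t Tt Xt C. apply (Hk t Tt Xt), E. split; [|exact C].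
    apply ext_pos in Xt. lia.
Qed.

Section NotGeneric.
Context (N : nat) (w : nat -> nat -> Prop) (G T : nat -> Prop).
Context (HT : Tower N w)
  (HG : forall i x, i < N -> (G (N * x + i) <-> w i x))
  (Path : forall k, T (pre G k))
  (Gen : forall f, meets_or_avoids T G (sigma2 T f)).

Definition decided (j k : nat) : Prop :=
  forall t, T t -> ext (pre G k) t ->
  forall i x b, i < j -> bit b t (N * x + i) -> lit b (w i x).

Lemma decided_mono j k k' : k <= k' -> decided j k -> decided j k'.
Proof.
  intros L D t Tt Xt. apply D; [exact Tt|].
  eapply ext_trans; [apply ext_pre, L|exact Xt].
Qed.

(** Consider the Sigma2 set of strings which have, for some instance of the
    condition, no extension in [T] forcing it. As [G] satisfies the condition it
    does not meet this set, so it avoids it. *)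
Lemma forces_dense p : setvars_lt N p -> Pi2 p w -> exists k, forall t, T t ->
  ext (pre G k) t -> forall a, exists t', ext t t' /\ T t' /\ forces 0 N w p a t'.
Proof.
  intros Bp HP.
  set (q := SEx (SAnd (Sext (Var 2) (Var 0)) (SAnd (SLit true 0 (Var 0))
                  (frc 0 N (Var 0) (inst (Var 1) p))))).
  assert (E : forall s a, ssat (fun _ => T) (scons a (env1 s)) q <->
    exists t', ext s t' /\ T t' /\ forces 0 N w p a t').
  { intros s a. unfold q. repeat first [ssat_step|apply ssat_ext; ev_tac
      |apply ssat_forces; [lia|ev_tac..]]. }
  destruct (generic_not_sigma T G q Gen) as [k [[a Ha]|Hk]].
  - destruct Ha. apply E.
    destruct (forces_complete 0 N w p a G) as [k0 F].
    + apply (ssat_agree N w); [exact Bp| |apply HP]. intros i Hi. apply set_ext.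
      intros x. unfold blk. simpl. rewrite Nat.sub_0_r. symmetry. auto.
    + exists (pre G (k + k0)). split; [apply ext_pre; lia|].
      split; [apply Path|apply F; lia].
  - exists k. intros t Tt Xt a. apply E, NNPP. intros C.
    apply (Hk t Tt Xt). exists a. exact C.
Qed.

(** A string of [T] beyond which the condition is densely forced lies on a
    solution; when the columns below [j] are decided, column [j] of this
    solution is included in [w j], which is the greatest. *)
Lemma column_included j p k : j < N ->
  (forall w', (forall i, i < j -> w' i = w i) -> Pi2 p w' ->
     forall x, w' j x -> w j x) ->
  decided j k ->
  (forall t, T t -> ext (pre G k) t -> forall a, exists t',
     ext t t' /\ T t' /\ forces 0 N w p a t') ->
  forall t, T t -> ext (pre G k) t ->
  forall x, bit true t (N * x + j) -> w j x.
Proof.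
  intros Lj Great D Dense t Tt Xt x Bt.
  set (A := fun t => T t /\ ext (pre G k) t).
  destruct (chain_exists A (step 0 N w p A) t) as (c & Ec & Hc).
  - split; assumption.
  - intros s n [Ts Xs]. destruct (Dense s Ts Xs n) as (s' & Es & Ts' & F).
    exists s'. assert (A s') by (split; [|apply (ext_trans _ s)]; assumption).
    split; [assumption|]. split; [|split]; assumption.
  - assert (Ac : forall n, A (c n)).
    { intros [|n]; [rewrite Ec; split; assumption|]. apply Hc. }
    destruct (chain_limit c G) as (Y & HY & NY); [intros n; apply Hc|].
    apply (Great (blk 0 N w Y)).
    + intros i Hi. apply set_ext. intros x'. unfold blk. simpl. rewrite Nat.sub_0_r.
      destruct (classic (exists n b, bit b (c n) (N * x' + i))) as [(n & b & B)|NB].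
      * destruct (Ac n) as [Tn Xn]. assert (Lb := D _ Tn Xn i x' b Hi B).
        destruct (HY n) as [m Em]. rewrite Em in B. apply bit_pre in B.
        unfold lit in Lb. tauto.
      * rewrite NY by (intros n b B; apply NB; eauto). apply HG. lia.
    + apply (chain_solution 0 N w p A c); assumption.
    + unfold blk. simpl. rewrite Nat.sub_0_r. destruct (HY 0) as [m Em].
      rewrite <- Ec, Em in Bt. apply bit_pre in Bt. apply Bt. reflexivity.
Qed.

(** Column by column. Once column [j] of every string of [T] above [pre G k2] is
    included in [w j], the strings lacking an element of [w j] form a Sigma1(T)
    set, because [w j] can be read off from the strings of [T] above [pre G k2].
    It is not met by [G], hence avoided. *)
Lemma decided_all j : j <= N -> exists k, decided j k.
Proof.
  induction j as [|j IH]; intros L.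
  { exists 0. intros t _ _ i x b Hi. lia. }
  destruct IH as [k0 D0]; [lia|].
  destruct (HT j) as (p & Bp & HP & Great); [lia|].
  destruct (forces_dense p Bp HP) as [k1 Dense].
  set (k2 := k0 + k1).
  assert (D2 : decided j k2) by (apply (decided_mono _ k0); [lia|exact D0]).
  assert (Inc : forall t, T t -> ext (pre G k2) t ->
                forall x, bit true t (N * x + j) -> w j x).
  { apply (column_included j p k2); [lia|exact Great|exact D2|].
    intros t Tt Xt. apply Dense; [exact Tt|].
    eapply ext_trans; [apply ext_pre|exact Xt]. lia. }
  (* the strings which disagree in column [j] with some string of [T] above
     [pre G k2] *)
  set (q := SEx (SEx (SAnd (Sbit false (Var 2) (num N * Var 1 + num j))
    (SAnd (SLit true 0 (Var 0)) (SAnd (Sext (num (pre G k2)) (Var 0))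
      (Sbit true (Var 0) (num N * Var 1 + num j))))))).
  assert (E : forall s, ssat (fun _ => T) (env1 s) q <-> exists x t,
    bit false s (N * x + j) /\ T t /\ ext (pre G k2) t /\ bit true t (N * x + j)).
  { intros s. unfold q. repeat first [ssat_step|apply ssat_ext; ev_tac
      |apply ssat_bit; ev_tac]. }
  destruct (generic_sigma T G q Gen) as [k3 [H3|H3]].
  - apply E in H3. destruct H3 as (x & t & B & Tt & Xt & B').
    apply bit_pre in B. apply (Inc t Tt Xt) in B'. apply HG in B'; [|lia].
    destruct B as [_ B]. apply B in B'. discriminate.
  - exists (k2 + k3). intros t Tt Xt i x b Hi B.
    assert (X2 : ext (pre G k2) t) by (eapply ext_trans; [apply ext_pre|exact Xt]; lia).
    assert (X3 : ext (pre G k3) t) by (eapply ext_trans; [apply ext_pre|exact Xt]; lia).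
    destruct (Nat.eq_dec i j) as [->|Dij]; [|apply (D2 t Tt X2 i x b); [lia|exact B]].
    destruct b.
    + apply lit_true. apply (Inc t Tt X2 x B).
    + apply lit_false. intros Wx. apply (H3 t Tt X3), E.
      exists x, (pre G (k2 + S (N * x + j))). split; [exact B|]. split; [apply Path|].
      split; [apply ext_pre; lia|]. apply bit_pre. split; [lia|].
      split; [intros _; apply HG; [lia|exact Wx]|auto].
Qed.

(** When all columns are decided, [G] is the only path of [T] beyond some
    initial segment, so [T] does not split there. *)
Lemma not_generic : 0 < N ->
  (forall s, T s -> exists t u, T t /\ T u /\ ext s t /\ ext s u /\
     ~ ext t u /\ ~ ext u t) -> False.
Proof.
  intros HN Split. destruct (decided_all N (le_n N)) as [k D].
  assert (P : forall t, T t -> ext (pre G k) t -> exists m, t = pre G m).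
  { intros t Tt Xt. destruct (string_pre t (ext_pos _ _ Xt)) as (H & m & ->).
    exists m. apply pre_agree. intros p Hp.
    assert (B : exists b, lit b (H p)).
    { destruct (classic (H p)); [exists true|exists false];
        [rewrite lit_true|rewrite lit_false]; assumption. }
    destruct B as [b Hb]. unfold lit in Hb.
    assert (E : p = N * (p / N) + p mod N) by (apply Nat.div_mod_eq).
    assert (L : p mod N < N) by (apply Nat.mod_upper_bound; lia).
    assert (C : lit b (w (p mod N) (p / N))).
    { apply (D _ Tt Xt _ _ _ L). rewrite <- E. apply bit_pre. tauto. }
    unfold lit in C. rewrite <- HG in C by exact L. rewrite <- E in C. tauto. }
  destruct (Split (pre G k) (Path k)) as (t & u & Tt & Tu & Xt & Xu & C1 & C2).
  destruct (P t Tt Xt) as [m ->]. destruct (P u Tu Xu) as [n ->].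
  destruct (Nat.le_ge_cases m n); [apply C1|apply C2]; apply ext_pre; assumption.
Qed.
End NotGeneric.

(** * Reading the formulas of the statement in an omega-model *)

Lemma Pow2_iff p :
  (p <> 0 /\ forall d q, p = d * q -> d = 1 \/ exists z, d = 2 * z) <->
  exists j, p = 2 ^ j.
Proof.
  split.
  - induction p as [p IH] using lt_wf_ind. intros [P0 Hp].
    destruct (Nat.eq_dec p 1) as [->|P1]; [exists 0; reflexivity|].
    destruct (Hp p 1) as [E|[z E]]; [lia|lia|].
    destruct (IH z) as [j Hj]; [lia| |exists (S j); simpl; lia].
    split; [lia|]. intros d q Ez. apply (Hp d (2 * q)). nia.
  - intros [j ->]. split; [apply Nat.pow_nonzero; lia|].
    induction j as [|j IH]; intros d q E.
    + left. simpl in E. symmetry in E. apply Nat.eq_mul_1 in E. apply E.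
    + destruct (Nat.Even_or_Odd d) as [[z Ed]|[z Ed]]; [right; eauto|].
      destruct (Nat.Even_or_Odd q) as [[y Eq]|[y Eq]].
      * apply (IH d y). simpl in E. nia.
      * exfalso. simpl in E. nia.
Qed.

Section Translation.
Context (U : (nat -> Prop) -> Prop) (v : nat -> nat) (w : nat -> nat -> Prop).

Lemma sat_Str s (s' : nat) : ev v s = s' -> sat (std U) v w (Str s) <-> s' <> 0.
Proof. intros <-. unfold Str. repeat sat_step; ev_tac. Qed.

Lemma sat_Pow2 p (p' : nat) : ev v p = p' ->
  sat (std U) v w (Pow2 p) <-> exists j, p' = 2 ^ j.
Proof.
  intros <-. rewrite <- Pow2_iff. unfold Pow2. repeat sat_step; ev_tac.
Qed.
End Translation.

Lemma sat_Ext U v w s t (s' t' : nat) : ev v s = s' -> ev v t = t' ->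
  sat (std U) v w (Ext s t) <-> ext s' t'.
Proof.
  intros <- <-. transitivity (ev v s <> 0 /\ exists p r, (exists j, p = 2 ^ j) /\
    r < p /\ ev v t = ev v s * p + r).
  - unfold Ext. repeat first [sat_step|apply sat_Str|apply sat_Pow2]; ev_tac.
  - unfold ext. rewrite Nat.neq_0_lt_0. apply and_iff_compat_l. split.
    + intros (p & r & [j ->] & L & E). eauto.
    + intros (j & r & L & E). eauto 6.
Qed.

Lemma sat_Beta U v w a b i r (a' b' i' r' : nat) :
  ev v a = a' -> ev v b = b' -> ev v i = i' -> ev v r = r' ->
  sat (std U) v w (Beta a b i r) <-> beta a' b' i' r'.
Proof. intros <- <- <- <-. unfold Beta, beta. repeat sat_step; ev_tac. Qed.

(** The sequence coded by [a] and [b] is determined by its recursion. *)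
Lemma sat_Restr U v w X k s (k' s' : nat) A : ev v k = k' -> ev v s = s' ->
  w X = A -> sat (std U) v w (Restr X k s) -> s' = pre A k'.
Proof.
  intros <- <- <- HR.
  assert (H : exists a b, beta a b 0 1 /\
    (forall i, i < ev v k -> exists c d, beta a b i c /\ beta a b (i + 1) d /\
       (w X i /\ d = 2 * c + 1 \/ ~ w X i /\ d = 2 * c)) /\
    beta a b (ev v k) (ev v s)).
  { revert HR. apply -> (sat_ExNum U v w). intros a.
    repeat first [sat_step|apply sat_Beta]; ev_tac. }
  destruct H as (a & b & H0 & HS & Hk). apply (beta_fun a b (ev v k)); [exact Hk|].
  apply (beta_seq a b (pre (w X))); [exact H0|]. intros i Hi Hc.
  destruct (HS i Hi) as (c & d & Hc' & Hd & C).
  rewrite (beta_fun _ _ _ _ _ Hc' Hc) in C. cbn [pre]. unfold b2n.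
  destruct excluded_middle_informative; destruct C as [[C ->]|[C ->]];
    try contradiction; [|rewrite Nat.add_0_r]; exact Hd.
Qed.

Lemma sat_Sigma02 U v w D T : sat (std U) v w (Sigma02 D T) <->
  exists V, U V /\ exists Z, U Z /\ val_class V /\ sat_class (w T) V Z /\
    exists f, forall s, w D s <-> s <> 0 /\ exists a, forall b,
      Z (np f (np b (np a (np s 0)))).
Proof.
  unfold Sigma02, Sat. repeat first [sat_step|apply sat_ValClass|apply sat_SatClass
    |apply sat_Str]; ev_tac.
Qed.

(** * The model *)

Definition tower_model : structure := std InM.

Lemma InM_empty : InM (fun _ => False).
Proof.
  assert (H : InM (fun x => ssat (fun _ _ => False) (env1 x) (SLt 0 0))).
  { apply (InM_sigma 0); [intros j; lia|exact I]. }
  eapply eq_ind; [exact H|]. apply set_ext. intros x. simpl. lia.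
Qed.

Lemma tower_model_axioms p : Pi11CA p -> models tower_model p.
Proof.
  intros Ax v w Hw. destruct Ax as [| | | | | | | |p|p [q [Aq ->]]].
  1-8: simpl; lia || auto.
  - intros H0 HS n. apply (sat_instN tower_model) in H0. induction n as [|n IH]; [exact H0|].
    specialize (HS n IH). apply sat_subst in HS.
    apply (eq_ind _ (fun e => sat tower_model e w p) HS).
    extensionality i. destruct i; simpl; [lia|reflexivity].
  - apply sat_ExSet with (P := fun X => forall x, X x <->
      forall Y, InM Y -> sat tower_model (scons x v) (scons Y w) q).
    + intros X. apply sat_AllNum. intros x.
      apply sat_Iff; [apply sat_Mem; reflexivity|].
      unfold shiftS. rewrite sat_subst. reflexivity.
    + exists (fun x => forall Y, sat tower_model (scons x v) (scons Y w) q).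
      split; [apply InM_comprehension; assumption|].
      intros x. split; [auto|]. intros H Y. apply NNPP. intros HY.
      destruct (InM_basis InM (Neg q) w (scons x v)) as (Y' & IY' & HY'); simpl; eauto.
      apply HY', H, IY'.
Qed.

(** In the model, a generic path through a perfect tree meets or avoids every
    Sigma2 set of strings: the satisfaction classes and the set itself are
    solutions of arithmetical conditions, hence the model contains such. *)
Lemma tower_model_generic v w X T : (forall i, InM (w i)) ->
  sat tower_model v w (TwoGeneric X T) ->
  (forall k, w T (pre (w X) k)) /\
  forall f, meets_or_avoids (w T) (w X) (sigma2 (w T) f).
Proof.
  intros Hw [Path Gen] % (sat_And InM v w _ _ _ _ (iff_refl _) (iff_refl _)).
  split.
  - intros k.
    assert (H : exists s, sat tower_model (scons s (scons k v)) w (Restr X (Var 1) (Var 0)) /\ w T s).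
    { revert k. revert Path. apply -> (sat_AllNum InM v w). intros k.
      apply sat_ExNum. intros s. apply sat_And; [reflexivity|].
      apply sat_Mem; reflexivity. }
    destruct H as (s & Hs & Ts).
    apply (sat_Restr _ _ _ _ _ _ k s (w X)) in Hs; [|reflexivity..]. congruence.
  - intros f.
    assert (HV : exists V, InM V /\ val_class V).
    { destruct val_class_exists as [V HV].
      destruct (InM_basis InM (ValClass 0) w v) as (V' & I' & H').
      - simpl. tauto.
      - exact Hw.
      - exists V. apply sat_ValClass. exact HV.
      - exists V'. split; [exact I'|]. apply sat_ValClass in H'. exact H'. }
    destruct HV as (V & IV & HV).
    assert (HZ : exists Z, InM Z /\ sat_class (w T) V Z).
    { destruct (sat_class_exists (w T) V) as [Z HZ].
      destruct (InM_basis InM (SatClass 1 2 0) (scons (w T) (scons V w)) v)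
        as (Z' & I' & H').
      - simpl. tauto.
      - intros [|[|i]]; simpl; auto.
      - exists Z. apply sat_SatClass. exact HZ.
      - exists Z'. split; [exact I'|]. apply sat_SatClass in H'. exact H'. }
    destruct HZ as (Z & IZ & HZ).
    destruct (truth3 (w T) V Z HV HZ f) as [n Hn].
    assert (ED : forall s, sigma2 (w T) f s <-> s <> 0 /\ exists a, forall b,
              Z (np n (np b (np a (np s 0))))).
    { intros s. apply and_iff_compat_l, ex_iff. intros a. apply all_iff. intros b.
      symmetry. apply Hn. }
    assert (ID : InM (sigma2 (w T) f)).
    { set (q := (AllNum (Var 0 IN 0 <-> (Str (Var 0) /\ ExNum (AllNum
        (Sat 1 (Var 3) (pair (Var 0) (pair (Var 1) (pair (Var 2) 0))))))))%L2).
      assert (Eq : forall D, sat tower_model (fun _ => n) (scons D (scons Z w)) q <->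
        forall s, D s <-> s <> 0 /\ exists a, forall b, Z (np n (np b (np a (np s 0))))).
      { intros D. unfold q, Sat, tower_model. repeat first [sat_step|apply sat_Str]; ev_tac. }
      destruct (InM_basis InM q (scons Z w) (fun _ => n)) as (D & IDD & HD).
      - simpl. tauto.
      - intros [|i]; simpl; auto.
      - exists (sigma2 (w T) f). apply Eq, ED.
      - eapply eq_ind; [exact IDD|]. apply set_ext. intros s.
        rewrite (proj1 (Eq D) HD s). symmetry. apply ED. }
    assert (Gen' : forall D, InM D -> sat tower_model v (scons D w) (Sigma02 0 (S T)) ->
      exists k s, sat tower_model (scons s (scons k v)) (scons D w) (Restr (S X) (Var 1) (Var 0)) /\
        (D s \/ forall t, w T t -> ext s t -> ~ D t)).
    { intros D IDD HD. specialize (Gen D IDD HD).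
      revert Gen. apply -> (sat_ExNum InM v (scons D w)). intros k.
      apply sat_ExNum. intros s. apply sat_And; [reflexivity|].
      repeat first [sat_step|apply sat_Ext]; ev_tac. }
    destruct (Gen' _ ID) as (k & s & Hs & C).
    + apply sat_Sigma02. exists V. split; [exact IV|]. exists Z. split; [exact IZ|].
      split; [exact HV|]. split; [exact HZ|]. exists n. exact ED.
    + apply (sat_Restr _ _ _ _ _ _ k s (w X)) in Hs; [|reflexivity..].
      subst s. exists k. exact C.
Qed.

Lemma sat_PerfectTree_split U v w T : sat (std U) v w (PerfectTree T) ->
  forall s, w T s -> exists t u, w T t /\ w T u /\ ext s t /\ ext s u /\
    ~ ext t u /\ ~ ext u t.
Proof.
  intros H.
  assert (E : sat (std U) v w (PerfectTree T) <->
    (exists s, w T s) /\ (forall s, w T s -> s <> 0) /\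
    (forall s t, w T s -> ext t s -> w T t) /\
    forall s, w T s -> exists t u, w T t /\ w T u /\ ext s t /\ ext s u /\
      ~ ext t u /\ ~ ext u t).
  { unfold PerfectTree. repeat first [sat_step|apply sat_Str|apply sat_Ext]; ev_tac. }
  apply E, H.
Qed.

(** ** The join of a tower *)

Fixpoint Sjoin (N n : nat) : sf :=
  match n with
  | 0 => SLt 0 0
  | S n => SOr (Sjoin N n)
      (SEx (SAnd (SEq (Var 1) (num N * Var 0 + num n)) (SLit true n (Var 0))))
  end.

Lemma ssat_join w N n m :
  ssat w (env1 m) (Sjoin N n) <-> exists i x, i < n /\ m = N * x + i /\ w i x.
Proof.
  induction n as [|n IH].
  - simpl. split; [lia|]. intros (i & x & L & _). lia.
  - transitivity ((exists i x, i < n /\ m = N * x + i /\ w i x) \/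
                  exists x, m = N * x + n /\ w n x).
    + simpl Sjoin. apply ssat_Or; [exact IH|]. repeat ssat_step.
    + split.
      * intros [(i & x & L & H)|(x & H)]; [exists i, x|exists n, x]; split; auto.
      * intros (i & x & L & H). destruct (Nat.eq_dec i n) as [->|D]; [eauto|].
        left. exists i, x. split; [lia|exact H].
Qed.

Lemma Tower_join N w : Tower N w ->
  exists G, InM G /\ forall i x, i < N -> (G (N * x + i) <-> w i x).
Proof.
  intros T. exists (fun m => ssat w (env1 m) (Sjoin N N)). split.
  - apply (InM_sigma N); [exact T|].
    assert (H : forall n, n <= N -> setvars_lt N (Sjoin N n)).
    { induction n as [|n IH]; intros L; simpl; [exact I|].
      split; [apply IH; lia|split; [exact I|lia]]. }
    apply H. lia.
  - intros i x L. rewrite ssat_join. split; [|eauto].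
    intros (i' & x' & L' & E & H).
    destruct (div_mod_block N i x L) as [E1 E2].
    destruct (div_mod_block N i' x' L') as [E3 E4].
    rewrite E in E1, E2. congruence.
Qed.

Lemma Tower_join_not_generic N w G v u X : Tower N w -> 0 < N ->
  (forall i x, i < N -> (G (N * x + i) <-> w i x)) ->
  (forall i, InM (u i)) -> u X = G ->
  ~ sat tower_model v u (TwoGenericForSomePerfectTree X).
Proof.
  intros HT HN HG Hu <- Gen.
  assert (H : exists T, InM T /\ sat tower_model v (scons T u) (PerfectTree 0) /\
            sat tower_model v (scons T u) (TwoGeneric (S X) 0)).
  { revert Gen. apply -> (sat_ExSet InM v u). intros T.
    apply sat_And; reflexivity. }
  destruct H as (T & IT & Perf & TG).
  apply tower_model_generic in TG; [|intros [|i]; simpl; auto]. destruct TG as [Path G2].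
  apply (not_generic N w (u X) T HT HG Path G2 HN).
  apply (sat_PerfectTree_split InM v (scons T u) 0 Perf).
Qed.

(** At the argument [<i, <N, j>>] this set differs from part [j] of column [i]
    of [W], the column being regarded as the join of [N] sets. *)
Lemma diagonal_InM W : InM W -> InM (fun d => exists i N j,
  d = cpair i (cpair N j) /\ ~ W (np i (N * d + j))).
Proof.
  intros (K & w & k & T & Lk & ->).
  set (p := SEx (SEx (SEx (SEx (SAnd (Spair (Var 3) (Var 0) (Var 4))
    (SAnd (Spair (Var 2) (Var 1) (Var 0))
      (SLit false k (pair (Var 3) (Var 2 * Var 4 + Var 1))))))))).
  eapply eq_ind; [apply (InM_sigma K w p T); simpl; auto|].
  apply set_ext. intros d.
  transitivity (exists i N j c, d = cpair i c /\ c = cpair N j /\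
                  ~ w k (np i (N * d + j))).
  - unfold p. repeat first [ssat_step|apply ssat_pair; ev_tac].
  - split; [intros (i & N & j & c & -> & -> & H)|intros (i & N & j & -> & H)]; eauto 8.
Qed.

Lemma tower_model_refutes : ~ models tower_model all_but_countably_many_2generic.
Proof.
  intros H. specialize (H (fun _ => 0) (fun _ _ => False) (fun _ => InM_empty)).
  assert (E : exists W, InM W /\ forall X, InM X ->
    sat tower_model (fun _ => 0) (scons X (scons W (fun _ _ => False)))
      (TwoGenericForSomePerfectTree 0) \/
    exists i, forall x, X x <-> W (np i x)).
  { revert H. apply -> (sat_ExSet InM (fun _ => 0) (fun _ _ => False)). intros W.
    apply sat_AllSet. intros X. cbv zeta.
    apply sat_Or; [reflexivity|]. repeat sat_step; ev_tac. }
  destruct E as (W & IW & HW).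
  destruct (diagonal_InM W IW) as (N & w & j & HT & Lj & ED).
  destruct (Tower_join N w HT) as (G & IG & HG).
  destruct (HW G IG) as [Gen|[i Hi]].
  - revert Gen. apply (Tower_join_not_generic N w G); try assumption; [lia| |reflexivity].
    intros [|[|n]]; simpl; auto using InM_empty.
  - set (d := cpair i (cpair N j)). set (D := fun d => _) in ED.
    assert (C : D d <-> ~ D d); [|tauto].
    transitivity (~ W (np i (N * d + j))).
    + split; [|intros HN; exists i, N, j; auto].
      intros (i' & N' & j' & F & HN). unfold d in F.
      apply cpair_inj in F. destruct F as [<- F].
      apply cpair_inj in F. destruct F as [<- <-]. exact HN.
    + rewrite <- Hi, HG by exact Lj. rewrite ED. reflexivity.
Qed.

Theorem corollary4p4 :
  ~ provable Pi11CA all_but_countably_many_2generic /\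
  exists M : structure,
    (forall p : fm, Pi11CA p -> models M p) /\
    ~ models M all_but_countably_many_2generic.
Proof.
  split.
  - intros D. apply tower_model_refutes. intros v w Hw.
    apply (soundness tower_model Pi11CA tower_model_axioms [] _ D v w Hw). intros g [].
  - exists tower_model. split; [exact tower_model_axioms|exact tower_model_refutes].
Qed.
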